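(* Let $A_1=a_1a_2a_3\cdots\in\{-1,1\}^\infty$ be the infinite concatenation $A_1=\tau_1\tau_2\tau_3\cdots$ of the finite words $\tau_n=1^n*(-1)^{n+1}$, $n\ge1$ (that is, $\tau_n$ consists of $n$ entries equal to $1$ followed by $n+1$ entries equal to $-1$). Then for every odd integer $p$, the set $$p\Lambda(A_1)=p\left\{\sum_{k=1}^n4^{k-1}\omega_k:\ \omega_k\in\{0,a_k\},\ n\ge1\right\}$$ is a spectrum for $\mu_4$.
   Context: $\mu_4$ denotes the middle-fourth Cantor measure: the unique Borel probability measure on $\mathbb{R}$ satisfying $\mu_4(\cdot)=\frac12\mu_4\circ\sigma_1^{-1}(\cdot)+\frac12\mu_4\circ\sigma_2^{-1}(\cdot)$, where $\sigma_1(x)=4^{-1}x$ and $\sigma_2(x)=4^{-1}(x+2)$. A discrete set $\Lambda\subseteq\mathbb{R}$ is a spectrum for a Borel probability measure $\mu$ on $\mathbb{R}$ if the family $\{e^{2\pi i\lambda x}:\lambda\in\Lambda\}$ is an orthonormal basis of $L^2(\mu)$. *)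

(* Defs.v *)
From HB Require Import structures.
From mathcomp Require Import all_boot all_order all_algebra.
From mathcomp Require Import all_classical all_reals all_analysis.
From mathcomp Require Export complex.

Set Implicit Arguments.
Unset Strict Implicit.
Unset Printing Implicit Defensive.

Import Order.TTheory GRing.Theory Num.Theory.
Import numFieldNormedType.Exports.

Local Open Scope classical_set_scope.
Local Open Scope ring_scope.
Local Open Scope complex_scope.

Section ComplexL2.
Context d (T : measurableType d) (R : realType).
Variable mu : {measure set T -> \bar R}.
Implicit Types f g : T -> R[i].

Definition cmeasurable f : Prop :=
  measurable_fun [set: T] (fun x => complex.Re (f x)) /\
  measurable_fun [set: T] (fun x => complex.Im (f x)).

Definition cintegral f : R[i] :=
  (\int[mu]_x complex.Re (f x))%R +i* (\int[mu]_x complex.Im (f x))%R.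

Definition L2norm f : \bar R := Lnorm mu 2%:E (fun x => (Normc.normc (f x))%:E).

(* Representatives of elements of the complex space L^2(mu): functions are not
   quotiented by a.e. equality, since all the notions below only depend on
   classes. *)
Definition L2 : set (T -> R[i]) :=
  [set f | cmeasurable f /\ (L2norm f < +oo)%E].

Definition L2inner f g : R[i] := cintegral (fun x => f x * (g x)^*).

Definition orthonormal_family (I : choiceType) (J : set I) (e : I -> T -> R[i])
    : Prop :=
  (forall i, J i -> L2 (e i)) /\
  (forall i j, J i -> J j -> L2inner (e i) (e j) = (i == j)%:R).

Definition total_family (I : choiceType) (J : set I) (e : I -> T -> R[i])
    : Prop :=
  forall f, L2 f -> forall eps : R, 0 < eps ->
    exists (s : seq I) (c : I -> R[i]), (forall i, i \in s -> J i) /\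
      (L2norm (fun x => (f x - \sum_(i <- s) c i * e i x)%R) < eps%:E)%E.

Definition orthonormal_basis (I : choiceType) (J : set I) (e : I -> T -> R[i])
    : Prop :=
  orthonormal_family J e /\ total_family J e.

End ComplexL2.

(* e^{2 pi i lambda x} *)
Definition expo (R : realType) (lambda x : R) : R[i] :=
  cos (2 * pi * lambda * x) +i* sin (2 * pi * lambda * x).

Definition discrete_subset (R : realType) (Lambda : set R) : Prop :=
  isolated Lambda = Lambda.

Definition is_spectrum (R : realType) (mu : probability (measurableTypeR R) R)
    (Lambda : set R) : Prop :=
  discrete_subset Lambda /\ orthonormal_basis mu Lambda (@expo R).

Definition sigma1 (R : realType) (x : R) : R := 4^-1 * x.
Definition sigma2 (R : realType) (x : R) : R := 4^-1 * (x + 2).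

Definition is_mu4 (R : realType) (mu : probability (measurableTypeR R) R)
    : Prop :=
  forall A : set (measurableTypeR R), measurable A ->
    mu A = ((2^-1)%:E * mu (@sigma1 R @^-1` A)
            + (2^-1)%:E * mu (@sigma2 R @^-1` A))%E.

Definition tau (n : nat) : seq int := nseq n 1 ++ nseq n.+1 (-1).

(* The letters of the infinite word tau_1 tau_2 tau_3 ... are numbered from 1
   (A1 0 is junk).  As no tau_n is empty, the k-th letter already occurs in
   tau_1 ... tau_k; A1_prefix says that every finite concatenation is a prefix. *)
Definition A1 (k : nat) : int :=
  nth 0 (flatten [seq tau n | n <- iota 1 k]) k.-1.

Definition Lambda (a : nat -> int) : set int :=
  [set x | exists (n : nat) (omega : nat -> int), (1 <= n)%N /\
     (forall k, (1 <= k <= n)%N -> omega k = 0 \/ omega k = a k) /\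
     x = \sum_(1 <= k < n.+1) 4 ^+ (k - 1) * omega k].

Lemma size_tau n : size (tau n) = (n + n.+1)%N.
Proof. by rewrite size_cat !size_nseq. Qed.

Lemma size_prefix m N :
  (N <= size (flatten [seq tau n | n <- iota m N]))%N.
Proof.
elim: N m => [//|N IH] m /=.
by rewrite size_cat size_tau addnS addSn ltnS (leq_trans (IH m.+1)) ?leq_addl.
Qed.

Lemma A1_prefix N k :
  (k < size (flatten [seq tau n | n <- iota 1 N]))%N ->
  nth 0 (flatten [seq tau n | n <- iota 1 N]) k = A1 k.+1.
Proof.
rewrite /A1 [k.+1.-1]/=; have := size_prefix 1 k.+1.
have pre a b : (a <= b)%N -> exists s, flatten [seq tau n | n <- iota 1 b] =
    flatten [seq tau n | n <- iota 1 a] ++ s.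
  move=> /subnKC <-; rewrite iotaD map_cat flatten_cat.
  by eexists.
by case: (leqP k.+1 N) => [|/ltnW] /pre[s ->] h1 h2; rewrite nth_cat ?h1 ?h2.
Qed.

(* Main.v *)
From HB Require Import structures.
Require Import Defs.
From mathcomp Require Import all_boot all_order all_algebra.
From mathcomp Require Import all_classical all_reals all_analysis.
From mathcomp Require Import measurable_realfun.
From mathcomp Require Import cyclic ring lra zify.

(** The squared modulus h of the Fourier transform of the measure satisfies
    h(xi) = cos^2(pi xi / 2) h(xi / 4) (pspec_rec), so h vanishes exactly at the
    integers 4^j m with m odd.  Two elements of Lambda first differ at some digit,
    where the difference is +1 or -1; hence their difference is 4^j times an odd
    number, and so is p times that difference.  This is orthogonality.

    For completeness, let L_n be the set of sums of the first n digits, and let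
    h_n be the product of the first n cosine factors, so that
    h(xi) = h_n(xi) h(xi / 4^n).  The frequencies p L_n form a spectrum of the
    n-th discrete approximation of the measure, that is, the sum of
    h_n(xi + p l) over l in L_n is 1 (sum_pmask).  Passing to the limit in this
    identity requires that no mass escapes, and a lower bound c > 0 for
    h((xi + p l) / 4^n), uniform in l in L_n and in infinitely many n, is enough
    (psum_complete): it dominates the tail of the n-th sum by 1/c times the tail of
    a convergent series.  As h is continuous and vanishes only at nonzero integers,
    such a bound holds as soon as p l / 4^n keeps a fixed distance from all nonzero
    integers k (pspec_lower).

    That distance is where the shape of A_1 matters.  With all digits equal to 1 it
    can fail: for p = 3 the numbers 3 (1 + 4 + ... + 4^(n-1)) / 4^n tend to 1.
    Choose M > 0 with p dividing 4^M - 1, and take n at the end of a window of M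
    digits 1 followed by M digits -1; the word contains such windows arbitrarily far
    out.  Write F and D for the numbers with digits chosen in the two blocks.  If
    p l / 4^n is very close to an integer k, then x = p D + 4^M k and
    y = 4^M x - p F are integers of absolute value at most |p| / 3.  They are
    congruent modulo p, so x = y, and then p (F + D) is divisible by 4^M although
    0 <= F + D < 4^M.  So F = D = 0, which forces x = 0 and k = 0 (window_gap).

    Completeness of the sums says that every exponential, of any real frequency,
    lies in the closed span S of the candidate basis (expo_approx).  It remains to
    see that S is all of L^2.  The real functions u all of whose modulations
    u e_xi lie in S are stable under multiplication by trigonometric polynomials
    and under dominated limits.  Powers (1 - q^n)^(n 2^n) of a trigonometric
    polynomial q sharpen to the indicator of the region q < 1/2.  The measure lives
    on [-1, 1], so for a suitable q this is the indicator of a half-line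
    (rappr_ray), and a Dynkin class argument followed by
    approximation by simple functions gives everything (appr_L2). *)

Set Implicit Arguments.
Unset Strict Implicit.
Unset Printing Implicit Defensive.

Import Order.TTheory GRing.Theory Num.Theory.
Import numFieldNormedType.Exports.

Local Open Scope classical_set_scope.
Local Open Scope ring_scope.
Local Open Scope complex_scope.

(** * Partial digit sums and the nearest-integer gap *)

(** The sums are listed with the top digit split off, since both the Parseval
    identity and the study of the last digits proceed by adding one digit at
    the top. *)
Fixpoint digit_sums (a : nat -> int) (n : nat) : seq int :=
  if n is m.+1 then
    digit_sums a m ++ [seq l + 4 ^+ m * a m.+1 | l <- digit_sums a m]
  else [:: 0].

Lemma LambdaP (a : nat -> int) (x : int) :
  Lambda a x <-> exists n, x \in digit_sums a n.
Proof.
split.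
- case=> n [om [_ [hom ->]]]; exists n.
  elim: n hom => [|n IH] hom; first by rewrite big_geq// inE.
  rewrite big_nat_recr//= subn1/= mem_cat.
  have {}IH : \sum_(1 <= k < n.+1) 4 ^+ (k - 1) * om k \in digit_sums a n.
    by apply: IH => k /andP[k1 kn]; apply: hom; rewrite k1 (leq_trans kn).
  have [->|->] := hom n.+1 (leqnn _).
    by rewrite mulr0 addr0 IH.
  by apply/orP; right; apply/mapP; eexists; [exact: IH|].
- case=> n xn.
  suff [om [hom ->]] : exists om : nat -> int,
      (forall k, (1 <= k <= n)%N -> om k = 0 \/ om k = a k) /\
      x = \sum_(1 <= k < n.+1) 4 ^+ (k - 1) * om k.
    (* at least one digit is required: append a vanishing one *)
    exists n.+1, (fun k => if (k <= n)%N then om k else 0); split => //; split.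
      move=> k /andP[k1 _]; case: leqP => kn; last by left.
      by apply: hom; rewrite k1.
    rewrite [RHS]big_nat_recr//= ltnn mulr0 addr0.
    by apply: eq_big_nat => k /andP[_]; rewrite ltnS => ->.
  elim: n x xn => [|n IH] x /=.
    rewrite inE => /eqP ->; exists (fun=> 0); split; last by rewrite big_geq.
    by move=> k _; left.
  have ext (om : nat -> int) c : c = 0 \/ c = a n.+1 ->
      (forall k, (1 <= k <= n)%N -> om k = 0 \/ om k = a k) ->
      exists om' : nat -> int,
      (forall k, (1 <= k <= n.+1)%N -> om' k = 0 \/ om' k = a k) /\
      \sum_(1 <= k < n.+1) 4 ^+ (k - 1) * om k + 4 ^+ n * c =
      \sum_(1 <= k < n.+2) 4 ^+ (k - 1) * om' k.
    move=> hc hom; exists (fun k => if (k <= n)%N then om k else c); split.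
      move=> k /andP[k1 kn]; case: leqP => kn'; first by apply: hom; rewrite k1.
      by have -> : k = n.+1 by lia.
    rewrite [RHS]big_nat_recr//= ltnn subn1/=; congr (_ + _).
    by apply: eq_big_nat => k /andP[_]; rewrite ltnS => ->.
  rewrite mem_cat => /orP[/IH[om [hom ->]]|/mapP[l /IH[om [hom ->]] ->]].
    have [om' [h e]] := ext om 0 (or_introl erefl) hom.
    by exists om'; split => //; rewrite -e mulr0 addr0.
  by have [om' [h e]] := ext om _ (or_intror erefl) hom; exists om'; rewrite -e.
Qed.

Lemma digit_sums_prefix (a : nat -> int) (n k : nat) :
  exists s, digit_sums a (n + k) = digit_sums a n ++ s.
Proof.
elim: k => [|k [s IH]]; first by exists [::]; rewrite addn0 cats0.
by rewrite addnS /= {1}IH -catA; eexists.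
Qed.

Section signs.
Variable a : nat -> int.
Hypothesis asign : forall k, a k.+1 = 1 \/ a k.+1 = -1.

Lemma digit_sums_bound n l : l \in digit_sums a n -> 3 * `|l| <= 4 ^+ n - 1.
Proof.
elim: n l => [|n IH] l /=; first by rewrite inE => /eqP ->.
rewrite mem_cat exprS => /orP[/IH|/mapP[l' /IH + ->]]; first by lia.
by have [->|->] := asign n; lia.
Qed.

(** At the lowest digit where the two sums differ, the difference of the
    digits is odd, and all higher digits contribute multiples of the next
    power of 4. *)
Lemma digit_sums_sub n l l' : l \in digit_sums a n -> l' \in digit_sums a n -> l <> l' ->
  exists j (m : int), [/\ (j < n)%N, odd `|m|%N & l - l' = 4 ^+ j * m].
Proof.
elim: n l l' => [|n IH] l l' /=.
  by rewrite !inE => /eqP -> /eqP ->.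
have oddA : odd `|a n.+1|%N by have [->|->] := asign n.
have key u v e : odd `|e|%N -> u \in digit_sums a n -> v \in digit_sums a n ->
    exists j (m : int), [/\ (j < n.+1)%N, odd `|m|%N &
      u - v + 4 ^+ n * e = 4 ^+ j * m].
  move=> oe un vn; have [->|/eqP uv] := eqVneq u v.
    by exists n, e; split => //; ring.
  have [j [m [jn om ->]]] := IH _ _ un vn uv.
  exists j, (m + 4 ^+ (n - j) * e); split; first exact: ltnW.
    have -> : (n - j = (n - j).-1.+1)%N by lia.
    by rewrite exprS; lia.
  by rewrite mulrDr mulrA -exprD subnKC 1?ltnW.
rewrite !mem_cat => /orP[ln|/mapP[u un ->]] /orP[ln'|/mapP[v vn ->]] ne.
- have [j [m [jn om e]]] := IH _ _ ln ln' ne.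
  by exists j, m; split => //; exact: ltnW.
- have oN : odd `|- a n.+1|%N by rewrite abszN.
  have [j [m [jn om e]]] := key _ _ _ oN ln vn; exists j, m; split => //.
  by rewrite -e; ring.
- have [j [m [jn om e]]] := key _ _ _ oddA un ln'; exists j, m; split => //.
  by rewrite -e; ring.
- have ne' : u <> v by move=> uv; apply: ne; rewrite uv.
  have [j [m [jn om e]]] := IH _ _ un vn ne'.
  by exists j, m; split; [exact: ltnW|by []|rewrite -e; ring].
Qed.

Lemma digit_sums_uniq n : uniq (digit_sums a n).
Proof.
elim: n => [//|n IH] /=.
rewrite cat_uniq IH map_inj_uniq ?IH ?andbT; last by move=> x y /addIr.
rewrite -all_predC; apply/allP => x /mapP[l ln ->] /=; apply/negP => ln'.
have h := digit_sums_bound ln; have h' := digit_sums_bound ln'.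
by have := asign n => -[] e; rewrite e in h'; lia.
Qed.

(** Separates a block of r equal letters at the top: up to the common sign,
    the chosen digits form a number with base-4 digits in {0, 1}. *)
Lemma digit_sums_run (e : int) m r l :
  (forall k, (m <= k < m + r)%N -> a k.+1 = e) -> l \in digit_sums a (m + r) ->
  exists l' (F : int), [/\ l' \in digit_sums a m, 0 <= F, 3 * F <= 4 ^+ r - 1 &
    l = l' + 4 ^+ m * (e * F)].
Proof.
elim: r l => [|r IH] l he.
  by rewrite addn0 => ln; exists l, 0; split => //; ring.
have he' k : (m <= k < m + r)%N -> a k.+1 = e by move=> ?; apply: he; lia.
rewrite addnS /= mem_cat he; last by lia.
move=> /orP[/(IH _ he')[l' [F [l'm F0 F3 ->]]]|].
  by exists l', F; split => //; rewrite exprS; lia.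
move=> /mapP[u /(IH _ he')[l' [F [l'm F0 F3 ->]]] ->].
exists l', (F + 4 ^+ r); rewrite exprS exprD; split => //; [|lia|ring].
by rewrite addr_ge0// exprn_ge0.
Qed.

End signs.

(** If p l / 4^n, with n = m + 2M, were too close to k, then x = p D + 4^M k
    and y = 4^M x - p F would both have absolute value at most |p| / 3.  Their
    difference is a multiple of p, because p divides 4^M - 1, hence it is 0.
    Substituting x = y shows that 4^M divides p (F + D), while F + D is less
    than 4^M and 4 is prime to p. *)
Lemma window_gap (p : int) (M m : nat) (R F D k : int) : (0 < M)%N ->
  odd `|p|%N -> (p %| 4 ^+ M - 1)%Z ->
  3 * `|R| <= 4 ^+ m -> 0 <= F -> 3 * F <= 4 ^+ M - 1 ->
  0 <= D -> 3 * D <= 4 ^+ M - 1 -> k != 0 ->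
  4 ^+ m < 10 * `|p * (R + 4 ^+ m * (F - 4 ^+ M * D)) - 4 ^+ (m + M + M) * k|.
Proof.
move=> M0 op pM Rb F0 Fb D0 Db k0.
rewrite ltNge; apply/negP => small; move/eqP: k0; apply.
(* x and y are kept abstract so that the linear arithmetic below stays small *)
have [x xE] : exists x, x = p * D + 4 ^+ M * k by eexists.
have [y yE] : exists y, y = 4 ^+ M * x - p * F by eexists.
have m0 : 0 < 4 ^+ m :> int by rewrite exprn_gt0.
have M1 : 4 <= 4 ^+ M :> int by rewrite -(prednK M0) exprS ler_peMr// exprn_ege1.
have p0 : 0 < `|p| by rewrite normr_gt0; apply: contraTneq op => ->.
have E : p * (R + 4 ^+ m * (F - 4 ^+ M * D)) - 4 ^+ (m + M + M) * k =
    p * R - 4 ^+ m * y by rewrite yE xE !exprD; ring.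
rewrite {}E in small.
have yb : 3 * `|y| <= `|p|.
  have pR : 3 * `|p * R| <= `|p| * 4 ^+ m.
    by rewrite normrM; nia.
  have my : `|4 ^+ m * y| = 4 ^+ m * `|y| by rewrite normrM gtr0_norm.
  have : 30 * (4 ^+ m * `|y|) <= 4 ^+ m * (10 * `|p| + 3) by rewrite -my; lia.
  by rewrite mulrCA ler_pM2l//; lia.
have xb : 3 * `|x| <= `|p|.
  have Mx : 4 ^+ M * `|x| = `|y + p * F|.
    by rewrite yE subrK normrM gtr0_norm//; lia.
  have pF : `|p * F| = `|p| * F by rewrite normrM (ger0_norm F0).
  have : 4 ^+ M * (3 * `|x|) <= 4 ^+ M * `|p|.
    have : `|p| * (3 * F) <= `|p| * (4 ^+ M - 1) by rewrite ler_pM2l.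
    by rewrite [X in _ -> X <= _]mulrCA Mx; lia.
  by rewrite ler_pM2l//; lia.
have yx : y = x.
  have : (p %| y - x)%Z.
    have -> : y - x = (4 ^+ M - 1) * x - p * F by rewrite yE; ring.
    by rewrite rpredB// dvdz_mulr.
  move=> /dvdzP[q yxq]; have : `|y - x| < `|p| by lia.
  rewrite yxq normrM -[X in _ < X]mul1r ltr_pM2r// => q1.
  have q0 : q = 0 by lia.
  by apply/eqP; rewrite -subr_eq0 yxq q0 mul0r.
have FD : F + D = 0.
  have : (4 ^+ M %| p * (F + D))%Z.
    apply/dvdzP; exists (x - k).
    by rewrite -[p * (F + D)]addr0 -(subrr x) -{1}yx yE xE; ring.
  rewrite Gauss_dvdzr; last first.
    by rewrite coprimezXl// coprimezE/= (@coprimeXl 2 2)// coprime2n.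
  move=> /dvdzP[q FDq].
  have q1 : q < 1 by rewrite -(@ltr_pM2r _ (4 ^+ M)) ?mul1r; lia.
  have qN1 : - 1 < q by rewrite -(@ltr_pM2r _ (4 ^+ M)) ?mulN1r; lia.
  have q0 : q = 0 by lia.
  by rewrite FDq q0 mul0r.
have [f0 d0] : F = 0 /\ D = 0 by lia.
have : (4 ^+ M - 1) * x = 0.
  by rewrite mulrBl mul1r -{2}yx yE f0; ring.
move=> /eqP; rewrite mulf_eq0 => /orP[|/eqP x0]; first by lia.
move: x0; rewrite xE d0 mulr0 add0r => /eqP; rewrite mulf_eq0 => /orP[|/eqP//].
by lia.
Qed.

Lemma odd_dvd_4X (p : int) : odd `|p|%N ->
  exists2 M, (0 < M)%N & (p %| 4 ^+ M - 1)%Z.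
Proof.
move=> op.
(* Euler's theorem, as p is odd *)
exists (totient `|p|%N); first by rewrite totient_gt0 odd_gt0.
have c4 : coprime 4 `|p|%N by rewrite (@coprimeXl 2 2)// coprime2n.
have := Euler_exp_totient c4 => /eqP; rewrite eqn_mod_dvd ?expn_gt0//.
rewrite dvdzE; suff -> : `|(4 ^+ totient `|p|%N - 1 : int)|%N =
  (4 ^ totient `|p|%N - 1)%N by [].
have : (0 < 4 ^ totient `|p|%N)%N by rewrite expn_gt0.
have -> : (4 : int) ^+ totient `|p|%N = (4 ^ totient `|p|%N)%N%:Z.
  by rewrite -natrX natz.
by lia.
Qed.

Lemma A1_sign k : A1 k.+1 = 1 \/ A1 k.+1 = -1.
Proof.
have : A1 k.+1 \in flatten [seq tau n | n <- iota 1 k.+1].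
  by rewrite /A1 mem_nth//; exact: (Defs.size_prefix 1 k.+1).
move=> /flattenP[s /mapP[n _ ->]]; rewrite mem_cat !mem_nseq.
by case/orP => /andP[_ /eqP ->]; [left|right].
Qed.

Lemma A1_window N M : exists2 m, (N <= m)%N &
  (forall k, (m <= k < m + M)%N -> A1 k.+1 = 1) /\
  (forall k, (m + M <= k < m + M + M)%N -> A1 k.+1 = -1).
Proof.
pose P := flatten [seq tau n | n <- iota 1 (N + M)].
(* the block tau_L with L > N + M is long enough on both sides *)
pose L := (N + M + 1)%N.
have PS : flatten [seq tau n | n <- iota 1 L] = P ++ tau L.
  by rewrite /L iotaD map_cat flatten_cat /= cats0 addn1.
have A1E k : (k < size (tau L))%N -> A1 (size P + k).+1 = nth 0 (tau L) k.
  move=> kL; rewrite -(@A1_prefix L) PS; last by rewrite size_cat ltn_add2l.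
  by rewrite nth_cat -{2}[size P]addn0 ltn_add2l ltn0 addKn.
exists (size P + (L - M))%N; first by rewrite /L; lia.
split=> k hk.
  have -> : k = (size P + (k - size P))%N by lia.
  rewrite A1E ?size_tau; last by lia.
  by rewrite nth_cat size_nseq ifT ?nth_nseq ?ifT//; lia.
have -> : k = (size P + (k - size P))%N by lia.
rewrite A1E ?size_tau; last by rewrite /L in hk *; lia.
rewrite nth_cat size_nseq ifF ?nth_nseq ?ifT//; rewrite /L in hk *; lia.
Qed.

(** The bound is uniform in l, k and in infinitely many n: p l / 4^n stays at
    distance more than 1 / (10 4^r) from every nonzero integer. *)
Lemma digit_sums_gap (p : int) : odd `|p|%N -> exists r : nat, forall N,
  exists2 n, (N <= n)%N & forall l k, l \in digit_sums A1 n -> k != 0 ->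
    4 ^+ n < 10 * 4 ^+ r * `|p * l - 4 ^+ n * k|.
Proof.
move=> op; have [M M0 pM] := odd_dvd_4X op; exists (M + M)%N => N.
have [m Nm [h1 hN1]] := A1_window N M; exists (m + M + M)%N; first by lia.
move=> l k ln k0.
have [l1 [D [l1n D0 Db ->]]] := digit_sums_run hN1 ln.
have [R [F [Rn F0 Fb ->]]] := digit_sums_run h1 l1n.
have Rb : 3 * `|R| <= 4 ^+ m by have := digit_sums_bound A1_sign Rn; lia.
have := window_gap M0 op pM Rb F0 Fb D0 Db k0.
have -> : R + 4 ^+ m * (F - 4 ^+ M * D) =
  R + 4 ^+ m * (1 * F) + 4 ^+ (m + M) * (-1 * D) by rewrite exprD; ring.
set z := `| _ - _ | => gz.
have -> : 4 ^+ (m + M + M) = 4 ^+ (M + M) * 4 ^+ m :> int.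
  by rewrite -exprD; congr (_ ^+ _); lia.
by rewrite -mulrA mulrCA ltr_pM2l ?exprn_gt0.
Qed.

(** * Trigonometric preliminaries *)

Section trigonometry.
Context {R : realType}.
Implicit Types x y : R.

(** Squaring the cosine removes the sign, so that the period is pi. *)
Lemma cos2Dpi_int x (k : int) : cos (x + pi * k%:~R) ^+ 2 = cos x ^+ 2.
Proof.
have nat_case y (n : nat) : cos (y + pi * n%:R) ^+ 2 = cos y ^+ 2.
  elim: n => [|n IH]; first by rewrite mulr0 addr0.
  by rewrite -natr1 mulrDr mulr1 addrA cosDpi sqrrN IH.
case: k => n; first exact: nat_case.
by rewrite -(nat_case (x + _) n.+1) NegzE mulrNz mulrN pmulrn addrNK.
Qed.

Lemma cos2Dpi_half_odd x (k : int) : odd `|k|%N ->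
  cos (x + pi * k%:~R / 2) ^+ 2 = sin x ^+ 2.
Proof.
move=> ok; have [j ->] : exists j : int, k = 2 * j + 1.
  by exists ((k - 1) %/ 2)%Z; lia.
have -> : x + pi * (2 * j + 1)%:~R / 2 = (x + pi / 2) + pi * j%:~R.
  by rewrite rmorphD rmorphM /=; field.
by rewrite cos2Dpi_int cosDpihalf sqrrN.
Qed.

Lemma cos_pi_half_eq0 y : cos (pi * y / 2) = 0 ->
  exists2 k : int, odd `|k|%N & y = k%:~R.
Proof.
(* t is y reduced to [-1, 1) modulo 2, where the cosine vanishes only at -1 *)
move=> c0; pose m := Num.floor ((y + 1) / 2); pose t := y - 2 * m%:~R.
have t0 : -1 <= t < 1.
  have h1 : m%:~R <= (y + 1) / 2 by exact: floor_le_tmp.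
  have h2 : (y + 1) / 2 < (m + 1)%:~R by exact: floorD1_gt.
  by rewrite rmorphD/= in h2; rewrite /t; lra.
have ct : cos (pi * t / 2) = 0.
  apply/eqP; rewrite -sqrf_eq0 -(cos2Dpi_int _ m).
  have -> : pi * t / 2 + pi * m%:~R = pi * y / 2 by rewrite /t; field.
  by rewrite c0 expr0n.
have tN1 : t = -1.
  apply/eqP; have := t0; rewrite eq_le => /andP[-> t1]; rewrite andbT leNgt.
  apply/negP => tN1; have := @cos_gt0_pihalf R (pi * t / 2).
  rewrite ct ltxx => /(_ _)/Bool.diff_false_true; apply.
  have p0 := pi_gt0 R; apply/andP; split; nra.
exists (2 * m - 1); first by lia.
by move: tN1; rewrite /t rmorphB rmorphM /=; lra.
Qed.

Lemma pow4_small (B rho : R) : 0 < rho ->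
  exists n0, forall n, (n0 <= n)%N -> B / 4 ^+ n < rho.
Proof.
move=> rho0; exists (Num.trunc (`|B| / rho)).+1 => n nn.
rewrite ltr_pdivrMr ?exprn_gt0// -ltr_pdivrMl// mulrC.
apply: (@le_lt_trans _ _ (`|B| / rho)).
  by rewrite ler_pM2r ?invr_gt0// ler_norm.
apply: (lt_le_trans (truncnS_gt _)).
have : ((Num.trunc (`|B| / rho)).+1 <= 4 ^ n)%N.
  by rewrite (leq_trans nn)// ltnW// ltn_expl.
by rewrite -(ler_nat R) natrX.
Qed.

End trigonometry.

(** * The Fourier transform of the Cantor measure *)

Section sigma_maps.
Context {R : realType}.
Local Notation T := (measurableTypeR R).

Lemma measurable_sigma1 : measurable_fun setT (@sigma1 R : T -> T).
Proof.
by apply: continuous_measurable_fun => x; exact: mulrl_continuous.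
Qed.

Lemma measurable_sigma2 : measurable_fun setT (@sigma2 R : T -> T).
Proof.
apply: continuous_measurable_fun => x.
apply: (@continuous_comp _ _ _ (fun x : R => x + 2) ( *%R 4^-1)).
  by apply: cvgD; [exact: cvg_id|exact: cvg_cst].
exact: mulrl_continuous.
Qed.

End sigma_maps.

Section fourier.
Context {R : realType} (mu : probability (measurableTypeR R) R).
Local Notation T := (measurableTypeR R).
Implicit Types (f : T -> R) (xi eta x : R).

(** Stated for any probability measure, because it is also applied to the
    images of the self-similar measure under the two contractions. *)
Lemma bounded_integrable (nu : probability T R) f K : measurable_fun setT f ->
  (forall x, `|f x| <= K) -> nu.-integrable setT (EFin \o f).
Proof.
move=> mf fK; apply: measurable_bounded_integrable => //.
  by rewrite (@le_lt_trans _ _ 1%E) ?probability_le1// ltry.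
exists K; split; first exact: num_real.
by move=> M KM x _ /=; exact: le_trans (fK x) (ltW KM).
Qed.

Lemma measurable_cosl xi : measurable_fun setT (fun x : T => cos (2 * pi * xi * x)).
Proof.
apply: continuous_measurable_fun => x.
apply: continuous_comp; first exact: mulrl_continuous.
exact: continuous_cos.
Qed.

Lemma measurable_sinl xi : measurable_fun setT (fun x : T => sin (2 * pi * xi * x)).
Proof.
apply: continuous_measurable_fun => x.
apply: continuous_comp; first exact: mulrl_continuous.
exact: continuous_sin.
Qed.

Lemma integrable_cos xi :
  mu.-integrable setT (EFin \o (fun x : T => cos (2 * pi * xi * x))).
Proof.
by apply: (@bounded_integrable mu _ 1); [exact: measurable_cosl|move=> x; exact: cos_max].
Qed.

Lemma integrable_sin xi :
  mu.-integrable setT (EFin \o (fun x : T => sin (2 * pi * xi * x))).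
Proof.
by apply: (@bounded_integrable mu _ 1); [exact: measurable_sinl|move=> x; exact: sin_max].
Qed.

Definition fcos xi : R := \int[mu]_x cos (2 * pi * xi * x).
Definition fsin xi : R := \int[mu]_x sin (2 * pi * xi * x).
(** The squared modulus of the Fourier transform, i.e. h in the introduction.
    *)
Definition pspec xi : R := fcos xi ^+ 2 + fsin xi ^+ 2.

Lemma continuous_fint (g : R -> R) : continuous g -> (forall x, `|g x| <= 1) ->
  continuous (fun xi => \int[mu]_x g (2 * pi * xi * x)).
Proof.
move=> cg g1 xi.
have cgl l : continuous (fun x : R => g (l * x)).
  by move=> x; apply: continuous_comp; [exact: mulrl_continuous|exact: cg].
apply: (@continuity_under_integral R _ (measurableTypeR R) mu
  (fun xi x => g (2 * pi * xi * x)) setT measurableT (xi - 1) (xi + 1) _ _ (cst 1)).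
- move=> x _; apply: (@bounded_integrable mu _ 1) => //.
  exact: continuous_measurable_fun.
- apply: aeW => y _ x _; apply: (@continuous_comp _ _ _ (fun xi => 2 * pi * xi * y)).
    by apply: cvgMl; apply: cvgMr; exact: cvg_id.
  exact: cg.
- by apply: (@bounded_integrable mu _ 1) => // x; rewrite normr1.
- by move=> x _; apply: aeW => y _.
- by rewrite inE/= in_itv/=; apply/andP; split; lra.
Qed.

Lemma continuous_pspec : continuous pspec.
Proof.
move=> xi; rewrite /pspec; apply: cvgD.
  apply: (@continuous_comp _ _ _ fcos (fun y => y ^+ 2)); last exact: exprn_continuous.
  by apply: continuous_fint; [exact: continuous_cos|exact: cos_max].
apply: (@continuous_comp _ _ _ fsin (fun y => y ^+ 2)); last exact: exprn_continuous.
by apply: continuous_fint; [exact: continuous_sin|exact: sin_max].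
Qed.

Lemma pspec_ge0 xi : 0 <= pspec xi.
Proof. by rewrite addr_ge0// sqr_ge0. Qed.

Lemma fcos0 : fcos 0 = 1.
Proof.
rewrite /fcos; under eq_Rintegral do rewrite mulr0 mul0r cos0.
by rewrite Rintegral_cst// [X in fine X](probability_setT mu) mulr1.
Qed.

Lemma fsin0 : fsin 0 = 0.
Proof.
rewrite /fsin; under eq_Rintegral do rewrite mulr0 mul0r sin0.
by rewrite Rintegral_cst// mul0r.
Qed.

Lemma pspec0 : pspec 0 = 1.
Proof. by rewrite /pspec fcos0 fsin0; ring. Qed.

(** The uniformity in eta is what allows finitely many frequencies to be
    treated at once. *)
Lemma pspec_near1 (B eps : R) : 0 < eps ->
  exists n0, forall n eta, (n0 <= n)%N -> `|eta| <= B ->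
    1 - eps <= pspec (eta / 4 ^+ n) <= 1 + eps.
Proof.
move=> e0; have /cvgrPdist_lt/(_ _ e0) := @continuous_pspec 0.
rewrite pspec0 => /nbhs_ballP[rho /= rho0 hrho].
have [n0 hn0] := pow4_small B rho0; exists n0 => n eta nn etaB.
have /hrho/ltr_normlP[] : ball 0 rho (eta / 4 ^+ n).
  rewrite -ball_normE /= sub0r normrN normrM normfV (@ger0_norm _ (4 ^+ n))//.
  apply: le_lt_trans (hn0 n nn); rewrite ler_pM2r// invr_gt0 exprn_gt0//.
by move=> h1 h2; apply/andP; split; lra.
Qed.

Hypothesis hmu : is_mu4 mu.

(** Invariance says that twice the measure is the sum of its two images; it is
    used in this form because the integral is additive in the measure. *)
Lemma mu4_integral f K : measurable_fun setT f -> (forall x, `|f x| <= K) ->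
  \int[mu]_x f x = 2^-1 * (\int[mu]_x f (sigma1 x) + \int[mu]_x f (sigma2 x)).
Proof.
move=> mf fK.
have m1 := @measurable_sigma1 R; have m2 := @measurable_sigma2 R.
have If : mu.-integrable setT (EFin \o f) by exact: (bounded_integrable mu mf fK).
have I1 : mu.-integrable setT (EFin \o (f \o (@sigma1 R : T -> T))).
  by apply: (@bounded_integrable mu _ K) => [|x]; [exact: measurableT_comp|exact: fK].
have I2 : mu.-integrable setT (EFin \o (f \o (@sigma2 R : T -> T))).
  by apply: (@bounded_integrable mu _ K) => [|x]; [exact: measurableT_comp|exact: fK].
have mEf : measurable_fun setT (EFin \o f) by exact/measurable_EFinP.
pose X1 : {mfun T >-> T} := HB.pack (@sigma1 R : T -> T) (isMeasurableFun.Build _ _ _ _ _ m1).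
pose X2 : {mfun T >-> T} := HB.pack (@sigma2 R : T -> T) (isMeasurableFun.Build _ _ _ _ _ m2).
have E : (\int[measure_add mu mu]_x (f x)%:E =
    \int[measure_add (distribution mu X1) (distribution mu X2)]_x (f x)%:E)%E.
  apply: eq_measure_integral => A mA _.
  transitivity (mu A + mu A)%E; first exact: measure_addE.
  transitivity (distribution mu X1 A + distribution mu X2 A)%E; last exact/esym/measure_addE.
  rewrite /distribution /pushforward (hmu mA).
  have mA1 : measurable (@sigma1 R @^-1` A) by rewrite -[X in measurable X]setTI; exact (m1 measurableT A mA).
  have mA2 : measurable (@sigma2 R @^-1` A) by rewrite -[X in measurable X]setTI; exact (m2 measurableT A mA).
  rewrite -(fineK (fin_num_measure mu _ mA1)) -(fineK (fin_num_measure mu _ mA2)).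
  by rewrite -!EFinM -!EFinD; congr EFin; field.
rewrite integral_measure_add// in E.
rewrite integral_measure_add// in E; [|exact: (bounded_integrable _ mf fK)..].
rewrite !integral_distribution// in E.
have E' : \int[mu]_x f x + \int[mu]_x f x =
    \int[mu]_x f (sigma1 x) + \int[mu]_x f (sigma2 x).
  have fin g : mu.-integrable setT (EFin \o g) -> (\int[mu]_x (g x)%:E \is a fin_num)%E.
    by move=> ig; exact: (integrable_fin_num _ ig).
  rewrite /Rintegral -(fineD (fin _ If) (fin _ If)) -(fineD (fin _ I1) (fin _ I2)).
  exact: congr1 E.
lra.
Qed.

Lemma fcos_rec xi : fcos xi =
  2^-1 * (fcos (xi / 4) + (cos (pi * xi) * fcos (xi / 4) - sin (pi * xi) * fsin (xi / 4))).
Proof.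
rewrite {1}/fcos (@mu4_integral _ 1); [|exact: measurable_cosl|by move=> x; exact: cos_max].
have e1 : \int[mu]_x cos (2 * pi * xi * sigma1 x) = fcos (xi / 4).
  by apply: eq_Rintegral => x _; congr cos; rewrite /sigma1; field.
have e2 : \int[mu]_x cos (2 * pi * xi * sigma2 x) =
    \int[mu]_x (cos (pi * xi) * cos (2 * pi * (xi / 4) * x) -
                sin (pi * xi) * sin (2 * pi * (xi / 4) * x)).
  by apply: eq_Rintegral => x _; rewrite -cosD; congr cos; rewrite /sigma2; field.
rewrite e1 e2 RintegralB// ?RintegralZl//.
all: try exact: integrable_cos.
all: try exact: integrable_sin.
  apply: (@bounded_integrable mu _ 1) => [|x].
    by apply: measurable_funM => //; exact: measurable_cosl.
  by rewrite normrM mulr_ile1// cos_max.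
apply: (@bounded_integrable mu _ 1) => [|x].
  by apply: measurable_funM => //; exact: measurable_sinl.
by rewrite normrM mulr_ile1// sin_max.
Qed.

Lemma fsin_rec xi : fsin xi =
  2^-1 * (fsin (xi / 4) + (sin (pi * xi) * fcos (xi / 4) + cos (pi * xi) * fsin (xi / 4))).
Proof.
rewrite {1}/fsin (@mu4_integral _ 1); [|exact: measurable_sinl|by move=> x; exact: sin_max].
have e1 : \int[mu]_x sin (2 * pi * xi * sigma1 x) = fsin (xi / 4).
  by apply: eq_Rintegral => x _; congr sin; rewrite /sigma1; field.
have e2 : \int[mu]_x sin (2 * pi * xi * sigma2 x) =
    \int[mu]_x (sin (pi * xi) * cos (2 * pi * (xi / 4) * x) +
                cos (pi * xi) * sin (2 * pi * (xi / 4) * x)).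
  by apply: eq_Rintegral => x _; rewrite -sinD; congr sin; rewrite /sigma2; field.
rewrite e1 e2 RintegralD// ?RintegralZl//.
all: try exact: integrable_cos.
all: try exact: integrable_sin.
  apply: (@bounded_integrable mu _ 1) => [|x].
    by apply: measurable_funM => //; exact: measurable_cosl.
  by rewrite normrM mulr_ile1// ?sin_max ?cos_max.
apply: (@bounded_integrable mu _ 1) => [|x].
  by apply: measurable_funM => //; exact: measurable_sinl.
by rewrite normrM mulr_ile1// ?cos_max ?sin_max.
Qed.

(** The transform satisfies F(xi) = (1 + e^(i pi xi)) / 2 F(xi / 4), and |1 +
    e^(i pi xi)| = 2 |cos(pi xi / 2)|. *)
Lemma pspec_rec xi : pspec xi = cos (pi * xi / 2) ^+ 2 * pspec (xi / 4).
Proof.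
have e : pi * xi = (pi * xi / 2) *+ 2 by rewrite mulr2n; field.
have ce : cos (pi * xi) = cos (pi * xi / 2) ^+ 2 * 2 - 1.
  by rewrite mulr_natr -cos_mulr2n -e.
have se : sin (pi * xi) = cos (pi * xi / 2) * sin (pi * xi / 2) * 2.
  by rewrite mulr_natr -sin_mulr2n -e.
rewrite /pspec (fcos_rec xi) (fsin_rec xi) ce se.
have := cos2Dsin2 (pi * xi / 2).
set c := cos _; set s := sin _; set u := fcos _; set v := fsin _ => cs.
have -> : 2^-1 * (u + ((c ^+ 2 * 2 - 1) * u - c * s * 2 * v)) = c * (c * u - s * v) by field.
have -> : 2^-1 * (v + (c * s * 2 * u + (c ^+ 2 * 2 - 1) * v)) = c * (s * u + c * v) by field.
transitivity (c ^+ 2 * ((c ^+ 2 + s ^+ 2) * (u ^+ 2 + v ^+ 2))); first by ring.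
by rewrite cs mul1r.
Qed.

Lemma pspec_zero j (m : int) : odd `|m|%N -> pspec ((4 ^+ j * m)%:~R) = 0.
Proof.
move=> om; elim: j => [|j IH].
  rewrite expr0 mul1r pspec_rec; have := @cos2Dpi_half_odd R 0 _ om.
  by rewrite add0r sin0 => ->; rewrite expr0n mul0r.
rewrite pspec_rec.
have -> : (4 ^+ j.+1 * m)%:~R / 4 = (4 ^+ j * m)%:~R :> R.
  by rewrite !rmorphM rmorphXn/= exprS rmorphXn/=; field.
by rewrite IH mulr0.
Qed.

(** Far along the orbit xi / 4^n the value is close to 1, and going back only
    multiplies by squared cosines.  One of them vanishes only if some xi / 4^n
    is an odd integer, and then xi is a nonzero integer. *)
Lemma pspec_gt0 xi : (forall k : int, k != 0 -> xi != k%:~R) -> 0 < pspec xi.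
Proof.
move=> nz; have [n0 /(_ n0 xi (leqnn _) (lexx _))] := @pspec_near1 `|xi| 2^-1 ltac:(by []).
move=> /andP[hn _]; have {hn} : 0 < pspec (xi / 4 ^+ n0) by lra.
elim: n0 => [|n IH]; first by rewrite expr0 divr1.
move=> h; apply: IH; rewrite pspec_rec.
have -> : xi / 4 ^+ n / 4 = xi / 4 ^+ n.+1 by rewrite exprSr invfM mulrA.
apply: mulr_gt0 => //; rewrite exprn_even_gt0//=; apply/negP => /eqP/cos_pi_half_eq0[k ok e].
have k0 : k != 0 by apply: contraTneq ok => ->.
have := nz (4 ^+ n * k); rewrite mulf_neq0 ?expf_neq0// => /(_ isT) /eqP; apply.
by rewrite rmorphM rmorphXn/= -e mulrC divfK// expf_neq0.
Qed.

(** The points considered form a compact set on which the continuous function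
    is positive. *)
Lemma pspec_lower (B delta : R) : 0 < delta -> exists2 c, 0 < c &
  forall xi, `|xi| <= B -> (forall k : int, k != 0 -> delta <= `|xi - k%:~R|) ->
  c <= pspec xi.
Proof.
move=> d0.
pose K := `[- B, B] `&` \bigcap_(k in [set k : int | k != 0]) [set xi : R | delta <= `|xi - k%:~R|].
have KE xi : `|xi| <= B -> (forall k : int, k != 0 -> delta <= `|xi - k%:~R|) -> K xi.
  by move=> xB hk; split; [rewrite /= in_itv/= -ler_norml|move=> k /= k0; exact: hk].
have [K0|] := eqVneq K set0.
  by exists 1 => // xi xB hk; have := KE _ xB hk; rewrite K0.
move=> /set0P K0.
have cK : compact K.
  apply: compact_closedI; first exact: segment_compact.
  apply: closed_bigI => k _.
  rewrite (_ : [set _ | _] = (fun x : R => `|x - k%:~R|) @^-1` [set y | delta <= y]).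
    apply: preimage_closed; last exact: closed_ge.
    move=> x _; apply: cvg_norm; apply: cvgB; [exact: cvg_id|exact: cvg_cst].
  by [].
have [|c /set_mem cinK cmin] := compact_EVT_min K0 cK (f := pspec).
  exact/continuous_subspaceT/continuous_pspec.
exists (pspec c).
  apply: pspec_gt0 => k k0; apply/eqP => ck.
  by have := cinK.2 k k0; rewrite /= ck subrr normr0 leNgt d0.
by move=> xi xB hk; apply: cmin; rewrite inE; exact: KE.
Qed.

End fourier.

(** * The Parseval identity for exponentials *)

Section parseval.
Context {R : realType} (mu : probability (measurableTypeR R) R).
Hypothesis hmu : is_mu4 mu.
Implicit Types (xi eta : R).

(** The squared modulus of the Fourier transform of the n-th discrete
    approximation of the measure. *)
Definition pmask n xi : R := \prod_(j < n) cos (pi * (xi / 4 ^+ j) / 2) ^+ 2.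

Lemma pmask_ge0 n xi : 0 <= pmask n xi.
Proof. by apply: prodr_ge0 => j _; exact: sqr_ge0. Qed.

Lemma pspec_pmask n xi : pspec mu xi = pmask n xi * pspec mu (xi / 4 ^+ n).
Proof.
elim: n => [|n IH]; first by rewrite /pmask big_ord0 mul1r divr1.
rewrite IH /pmask big_ord_recr/= -mulrA; congr (_ * _).
rewrite (pspec_rec hmu); congr (_ * pspec _ _).
by rewrite exprSr invfM mulrA.
Qed.

(** Both factors of the product formula are controlled: the cosines by 1, and
    the remaining value by its limit 1. *)
Lemma pspec_le1 xi : pspec mu xi <= 1.
Proof.
apply/ler_addgt0Pr => e e0.
have [n0 /(_ n0 xi (leqnn _) (lexx _)) /andP[_ h]] := pspec_near1 mu `|xi| e0.
rewrite (pspec_pmask n0) -[leRHS]mul1r ler_pM// ?pmask_ge0 ?pspec_ge0//.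
by apply: prodr_ile1 => j _; rewrite sqr_ge0/= cos2sin2 lerBlDr lerDl sqr_ge0.
Qed.

(** All n factors have a period dividing 4^n after squaring; this is what
    makes the top digit invisible to the first n factors. *)
Lemma pmaskD n xi (m : int) : pmask n (xi + (4 ^+ n * m)%:~R) = pmask n xi.
Proof.
apply: eq_bigr => j _; have -> : pi * ((xi + (4 ^+ n * m)%:~R) / 4 ^+ j) / 2 =
    pi * (xi / 4 ^+ j) / 2 + pi * (2 * 4 ^+ (n - j).-1 * m)%:~R.
  have -> : (4 ^+ n : int) = 4 ^+ j * (4 * 4 ^+ (n - j).-1).
    by rewrite -exprS -exprD; congr (_ ^+ _); have := ltn_ord j; lia.
  rewrite !rmorphM !rmorphXn/=; field; rewrite expf_neq0//.
exact: cos2Dpi_int.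
Qed.

(** When the top digit is added, the frequencies l and l + 4^n a_(n+1) have
    the same first n factors, and their last factors are a squared cosine and
    the corresponding squared sine, because p a_(n+1) is odd. *)
Lemma sum_pmask (a : nat -> int) (p : int) n xi :
  (forall k, a k.+1 = 1 \/ a k.+1 = -1) -> odd `|p|%N ->
  \sum_(l <- digit_sums a n) pmask n (xi + (p * l)%:~R) = 1.
Proof.
move=> asign op; elim: n => [|n IH] /=.
  by rewrite big_seq1 /pmask big_ord0.
rewrite big_cat big_map /= -big_split/= -[RHS]IH; apply: eq_bigr => l _.
have -> : xi + (p * (l + 4 ^+ n * a n.+1))%:~R =
    xi + (p * l)%:~R + (4 ^+ n * (p * a n.+1))%:~R.
  by rewrite -addrA -rmorphD /=; congr (_ + _%:~R); ring.
set y := xi + _.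
rewrite /pmask !big_ord_recr/= -!/(pmask _ _) pmaskD -mulrDr.
have -> : pi * ((y + (4 ^+ n * (p * a n.+1))%:~R) / 4 ^+ n) / 2 =
   pi * (y / 4 ^+ n) / 2 + pi * (p * a n.+1)%:~R / 2.
  by rewrite rmorphM rmorphXn/=; field; rewrite expf_neq0.
rewrite cos2Dpi_half_odd ?cos2Dsin2 ?mulr1//.
by have [->|->] := asign n; lia.
Qed.

Definition psum p xi N : R := \sum_(l <- digit_sums A1 N) pspec mu (xi + (p * l)%:~R).

(** Let N be so large that the sums beyond N grow by less than e c.  In the
    identity of level n, the part over the first N digits is close to the N-th
    sum, since h((xi + p l) / 4^n) is near 1 there.  The other frequencies
    contribute at most 1/c times the growth beyond N, i.e. at most e. *)
Lemma psum_complete (p : int) xi eps : odd `|p|%N -> 0 < eps ->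
  exists N, 1 - eps <= psum p xi N.
Proof.
move=> op; wlog e1 : eps / eps <= 1.
  move=> H e0; have [|e1] := leP eps 1; first by move=> /H; exact.
  exists 0%N; apply: (@le_trans _ _ 0); first by lra.
  by apply: sumr_ge0 => *; exact: pspec_ge0.
pose s := psum p xi.
have s1 n : s n <= 1.
  rewrite -(sum_pmask n xi A1_sign op) ler_sum// => l _.
  by rewrite (pspec_pmask n) ler_piMr ?pmask_ge0 ?pspec_le1.
have snd n k t : digit_sums A1 (n + k) = digit_sums A1 n ++ t ->
    s (n + k)%N = s n + \sum_(l <- t) pspec mu (xi + (p * l)%:~R).
  by move=> e; rewrite /s /psum e big_cat.
suff H e : 0 < e <= 1 -> exists N, (1 - e) ^+ 2 <= s N.
  move=> e0; have [|N hN] := H (eps / 2); first by lra.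
  by exists N; apply: le_trans hN; rewrite -/s; nra.
move=> /andP[e0 {}e1].
have [r gapr] := digit_sums_gap op.
(* half of the gap: the other half absorbs the shift by xi / 4^n *)
pose delta : R := (20 * 4 ^+ r)^-1.
have d0 : 0 < delta by rewrite invr_gt0 mulr_gt0// exprn_gt0.
have [c c0 hc] := pspec_lower hmu (delta + `|p|%:~R) d0.
have [N hN] : exists N, forall n, s n - s N <= e * c.
  have hs : has_sup (range s).
    by split; [exists (s 0%N), 0%N|exists 1 => _ [n _ <-]].
  have [_ [N _ <-] hN] := sup_adherent (mulr_gt0 e0 c0) hs.
  exists N => n; have : s n <= sup (range s) by apply: ub_le_sup; [exact: hs.2|exists n].
  by move: hN; lra.
exists N.
have [n1 hn1] := pow4_small `|xi| d0.
have [n2 hn2] := pspec_near1 mu (`|xi| + `|p|%:~R * 4 ^+ N) e0.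
have [n nn hn] := gapr (N + (n1 + n2))%N.
have [t Lt] := digit_sums_prefix A1 N (n - N).
have nE : (N + (n - N) = n)%N by lia.
have sE := snd _ _ _ Lt; rewrite nE in Lt sE.
have lb M l : l \in digit_sums A1 M -> `|(p * l)%:~R : R| <= `|p|%:~R * 4 ^+ M.
  move=> /(digit_sums_bound A1_sign) lM; rewrite -intr_norm normrM rmorphM /=.
  have -> : 4 ^+ M = (4 ^+ M : int)%:~R :> R by rewrite rmorphXn.
  by rewrite ler_wpM2l ?ler0z// ler_int; lia.
have near : forall l, l \in digit_sums A1 N ->
    (1 - e) * pmask n (xi + (p * l)%:~R) <= pspec mu (xi + (p * l)%:~R).
  move=> l lN; rewrite (pspec_pmask n) mulrC ler_wpM2l ?pmask_ge0//.
  have n2n : (n2 <= n)%N by lia.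
  have [] := andP (hn2 n (xi + (p * l)%:~R) n2n _) => //.
  by rewrite (le_trans (ler_normD _ _))// lerD2l lb.
have far : forall l, l \in digit_sums A1 n ->
    c * pmask n (xi + (p * l)%:~R) <= pspec mu (xi + (p * l)%:~R).
  move=> l ln; rewrite (pspec_pmask n) mulrC ler_wpM2l ?pmask_ge0//.
  have xin : `|xi / 4 ^+ n| < delta.
    rewrite normrM normfV (@ger0_norm _ (4 ^+ n)) ?exprn_ge0//.
    by apply: hn1; lia.
  apply: hc => [|k k0].
    rewrite mulrDl (le_trans (ler_normD _ _))// lerD//; first exact: ltW.
    rewrite normrM normfV (@ger0_norm _ (4 ^+ n)) ?exprn_ge0//.
    by rewrite ler_pdivrMr ?exprn_gt0// lb.
  have : 2 * delta <= `|(p * l)%:~R / 4 ^+ n - k%:~R|.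
    have := hn l k ln k0; rewrite -(ltr_int R) !rmorphM rmorphXn/= intr_norm.
    rewrite rmorphB !rmorphM !rmorphXn/= !rmorph_nat => h.
    have n4 : 0 < 4 ^+ n :> R by rewrite exprn_gt0.
    have r4 : 0 < 4 ^+ r :> R by rewrite exprn_gt0.
    rewrite -(ler_pM2r n4) -[X in _ <= _ * X](gtr0_norm n4) -normrM mulrBl divfK ?gt_eqF//.
    have -> : 2 * delta * 4 ^+ n = 4 ^+ n / (10 * 4 ^+ r).
      by rewrite /delta; field; rewrite gt_eqF.
    rewrite ler_pdivrMr ?mulr_gt0// ltW// (lt_le_trans h)//.
    by rewrite mulrC (mulrC k%:~R).
  have -> : (p * l)%:~R / 4 ^+ n - k%:~R =
     ((xi + (p * l)%:~R) / 4 ^+ n - k%:~R) - xi / 4 ^+ n by rewrite mulrDl; ring.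
  by have := ler_normB ((xi + (p * l)%:~R) / 4 ^+ n - k%:~R) (xi / 4 ^+ n); lra.
have := sum_pmask n xi A1_sign op; rewrite Lt big_cat/=.
set S1 := \sum_(l <- digit_sums A1 N) _; set S2 := \sum_(l <- t) _ => S12.
have hS1 : (1 - e) * S1 <= s N.
  by rewrite mulr_sumr /s /psum big_seq [leRHS]big_seq ler_sum.
have hS2 : c * S2 <= s n - s N.
  rewrite sE addrAC subrr add0r mulr_sumr big_seq [leRHS]big_seq ler_sum// => l lt.
  by apply: far; rewrite Lt mem_cat lt orbT.
have : S2 <= e.
  by rewrite -(ler_pM2l c0) (le_trans hS2)// mulrC.
move=> S2e; apply: le_trans hS1.
by rewrite expr2 ler_wpM2l//; lra.
Qed.

End parseval.

(** * A sharp threshold, and the support of the measure *)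

Section sharp_threshold.
Context {R : realType}.
Implicit Types (q z x : R).

Lemma bernoulli_ge x m : 0 <= x <= 1 -> 1 - m%:R * x <= (1 - x) ^+ m.
Proof.
move=> x01; elim: m => [|m IH]; first by rewrite expr0; lra.
have h : (1 - x) * (1 - m%:R * x) <= (1 - x) * (1 - x) ^+ m.
  by rewrite ler_wpM2l//; lra.
have m0 : 0 <= m%:R :> R by [].
rewrite exprS -natr1; nra.
Qed.

Lemma bernoulli_le x m : 0 <= x <= 1 -> (1 - x) ^+ m * (1 + m%:R * x) <= 1.
Proof.
move=> x01; elim: m => [|m IH]; first by rewrite expr0; lra.
have m0 : 0 <= m%:R :> R by [].
have p0 : 0 <= (1 - x) ^+ m by rewrite exprn_ge0//; lra.
apply: le_trans IH; rewrite exprS mulrAC -[leLHS]mulrA mulrC -subr_ge0 -natr1.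
set k := m%:R in m0 *; set y := (1 - x) ^+ m in p0 *.
have -> : y * (1 + k * x) - (1 + (k + 1) * x) * y * (1 - x) =
   y * ((k + 1) * (x * x)) by ring.
by rewrite !mulr_ge0//; lra.
Qed.

Lemma cvg_natr_expr z : 0 <= z < 1 -> n%:R * z ^+ n @[n --> \oo] --> 0.
Proof.
move=> /andP[z0 z1]; pose w := Num.sqrt z.
have w0 : 0 <= w := sqrtr_ge0 z.
have w1 : w < 1 by rewrite -sqrtr1 ltr_sqrt.
have zw : z = w * w by rewrite -expr2 sqr_sqrtr.
(* compare with the geometric sum 1 + w + ... + w^(n-1) *)
have nw n : n%:R * w ^+ n <= (1 - w)^-1.
  rewrite -[_^-1]mul1r ler_pdivlMr ?subr_gt0//.
  apply: (@le_trans _ _ (1 - w ^+ n)); last by rewrite lerBlDr lerDl exprn_ge0.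
  elim: n => [|n IH]; first by rewrite mul0r mul0r expr0 subrr.
  have wn : 0 <= w ^+ n by rewrite exprn_ge0.
  have n0 : 0 <= n%:R :> R by [].
  rewrite -natr1 exprS.
  have : (n%:R * w ^+ n * (1 - w)) * w <= (1 - w ^+ n) * w by rewrite ler_wpM2r.
  have : 0 <= (1 - w * w ^+ n) * (1 - w).
    by rewrite mulr_ge0 ?subr_ge0 ?(ltW w1)// -exprS exprn_ile1// ltW.
  by set y := w ^+ n; set k := n%:R; nra.
apply: (@squeeze_cvgr _ _ _ _ (fun=> 0) (fun n => (1 - w)^-1 * w ^+ n)).
- apply: nearW => n; rewrite mulr_ge0 ?exprn_ge0//= zw exprMn mulrA.
  by rewrite ler_wpM2r ?exprn_ge0.
- exact: cvg_cst.
- rewrite -[X in _ --> X](mulr0 (1 - w)^-1); apply: cvgMr; apply: cvg_expr.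
  by rewrite ger0_norm.
Qed.

(** Below the threshold, Bernoulli's inequality gives the lower bound 1 - n (2
    q)^n, which tends to 1.  At and above it, the upper bound is 1 / (1 + n (2
    q)^n).  The exponent n 2^n rather than 2^n gives the limit 0, not 1/e, at
    q = 1/2. *)
Lemma cvg_sharp q : 0 <= q <= 1 ->
  (1 - q ^+ n) ^+ (n * 2 ^ n) @[n --> \oo] --> ((q < 2^-1)%R%:R : R).
Proof.
move=> /andP[q0 q1].
have qn n : 0 <= q ^+ n <= 1 by rewrite exprn_ge0// exprn_ile1.
have e0 n : 0 <= (1 - q ^+ n) ^+ (n * 2 ^ n).
  by rewrite exprn_ge0// subr_ge0; case/andP: (qn n).
have mE n : (n * 2 ^ n)%:R * q ^+ n = n%:R * (2 * q) ^+ n :> R.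
  by rewrite natrM natrX exprMn mulrA.
have [q2|q2] := ltP q 2^-1.
- apply: (@squeeze_cvgr _ _ _ _ (fun n => 1 - n%:R * (2 * q) ^+ n) (fun=> 1)).
  + apply: nearW => n; rewrite -mE bernoulli_ge//=.
    by rewrite exprn_ile1//; case/andP: (qn n); lra.
  + rewrite -[X in _ --> X]subr0; apply: cvgB; first exact: cvg_cst.
    by apply: cvg_natr_expr; lra.
  + exact: cvg_cst.
- apply: (@squeeze_cvgr _ _ _ _ (fun=> 0) (fun n => n.+1%:R^-1)).
  + apply: nearW => n; rewrite e0/= -[leRHS]mul1r ler_pdivlMr ?ltr0n//.
    apply: le_trans (bernoulli_le (n * 2 ^ n) (qn n)); rewrite ler_wpM2l//.
    rewrite mE -natr1 addrC lerD2l ler_peMr// exprn_ege1//; lra.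
  + exact: cvg_cst.
  + exact: cvg_harmonic.
Qed.

End sharp_threshold.

Lemma measurable_norm_gt {R : realType} (r : R) :
  measurable [set x : measurableTypeR R | r < `|x|].
Proof.
rewrite (_ : [set x | _] = (fun x : R => `|x|) @^-1` `]r, +oo[%classic).
  have mn : measurable_fun setT (fun x : measurableTypeR R => `|x|).
    by apply: continuous_measurable_fun; exact: norm_continuous.
  by rewrite -[X in measurable X]setTI; exact: mn.
by apply/seteqP; split => x; rewrite /= in_itv/= andbT.
Qed.

Section support.
Context {R : realType} (mu : probability (measurableTypeR R) R).
Hypothesis hmu : is_mu4 mu.
Local Notation T := (measurableTypeR R).

(** The preimages under both contractions of the region |x| > r lie in |x| > 2
    r when r >= 1.  So the mass of |x| > 1 is at most that of |x| > 2^n for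
    every n, which tends to 0. *)
Lemma mu4_support : mu [set x : T | 1 < `|x|] = 0%E.
Proof.
pose E (r : R) : set T := [set x | r < `|x|].
have mE r : measurable (E r) by exact: measurable_norm_gt.
have E2 r : 1 <= r -> (mu (E r) <= mu (E (2 * r)%R))%E.
  move=> r1; rewrite (hmu (mE r)).
  have sub1 : @sigma1 R @^-1` E r `<=` E (2 * r).
    move=> x; rewrite /E /sigma1 /= normrM gtr0_norm//.
    by have := normr_ge0 x; lra.
  have sub2 : @sigma2 R @^-1` E r `<=` E (2 * r).
    move=> x; rewrite /E /sigma2 /= normrM gtr0_norm//.
    by have := ler_normD x 2; rewrite (@ger0_norm _ 2)//; lra.
  have ms1 : measurable (@sigma1 R @^-1` E r).
    rewrite -[X in measurable X]setTI; apply: (measurable_sigma1 measurableT) => //.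
  have ms2 : measurable (@sigma2 R @^-1` E r).
    rewrite -[X in measurable X]setTI; apply: (measurable_sigma2 measurableT) => //.
  have h1 : (mu (@sigma1 R @^-1` E r) <= mu (E (2 * r)%R))%E by rewrite le_measure ?inE.
  have h2 : (mu (@sigma2 R @^-1` E r) <= mu (E (2 * r)%R))%E by rewrite le_measure ?inE.
  apply: le_trans (leeD (lee_wpmul2l _ h1) (lee_wpmul2l _ h2)) _ => //.
  rewrite -(fineK (fin_num_measure mu _ (mE (2 * r)))) -!EFinM -EFinD lee_fin.
  by lra.
have En n : (mu (E 1%R) <= mu (E (2 ^+ n)%R))%E.
  elim: n => [|n IH]; first by rewrite expr0.
  by rewrite (le_trans IH)// exprS E2// exprn_ege1// ler1n.
have cap0 : \bigcap_n E (2 ^+ n) = set0.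
  rewrite -subset0 => x Ex.
  have [n0 /(_ n0 (leqnn _))] := pow4_small `|x| (@ltr01 R).
  rewrite ltr_pdivrMr ?exprn_gt0// mul1r => x4.
  have := Ex (2 * n0)%N I; rewrite /E /= exprM.
  have -> : 2 ^+ 2 = 4 :> R by rewrite expr2 -natrM.
  by rewrite ltNge ltW.
have := @nonincreasing_cvg_mu _ _ _ mu (fun n => E (2 ^+ n)).
rewrite cap0 measure0 => h.
have {}h : (mu \o (fun n => E (2 ^+ n))) @ \oo --> 0%E.
  apply: h => //.
  - by rewrite (@le_lt_trans _ _ 1%E) ?probability_le1// ltry.
  - move=> n m nm; rewrite subsetEset => x; apply: le_lt_trans.
    by rewrite ler_weXn2l// ler1n.
apply/eqP; rewrite -measure_le0 -(cvg_lim _ h)//.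
apply: lime_ge; first by apply/cvg_ex; exists 0%E.
by apply: nearW => n; exact: En.
Qed.

End support.

(** * The square norm *)

Section square_norm.
Context {R : realType} (mu : probability (measurableTypeR R) R).
Local Notation T := (measurableTypeR R).
Implicit Types (f g : T -> R[i]) (z : R[i]).

Definition nsq z : R := complex.Re z ^+ 2 + complex.Im z ^+ 2.
(** Working with the square of the norm, an integral of a nonnegative
    function, makes the linear and the limiting arguments direct. *)
Definition sq f : \bar R := (\int[mu]_x (nsq (f x))%:E)%E.

Lemma nsq_ge0 z : 0 <= nsq z.
Proof. by rewrite addr_ge0 ?sqr_ge0. Qed.

Lemma nsqM z1 z2 : nsq (z1 * z2) = nsq z1 * nsq z2.
Proof. by case: z1 z2 => [a b] [c d]; rewrite /nsq /=; ring. Qed.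

(** The crude constant 2 replaces Minkowski's inequality, as only closure
    under sums and limits matters later. *)
Lemma nsqD z1 z2 : nsq (z1 + z2) <= 2 * nsq z1 + 2 * nsq z2.
Proof.
case: z1 z2 => [a b] [c d]; rewrite /nsq /=.
by have := sqr_ge0 (a - c); have := sqr_ge0 (b - d); rewrite !expr2; nra.
Qed.

Lemma nsq_conj z : (nsq z)%:C = z * conjc z.
Proof.
by case: z => a b; rewrite /nsq /=; congr (_ +i* _); rewrite ?mulrN ?opprK; ring.
Qed.

Lemma nsq_real (u : R) : nsq u%:C = u ^+ 2.
Proof. by rewrite /nsq /= expr0n addr0. Qed.

Lemma cmeasurableD f g : cmeasurable f -> cmeasurable g ->
  cmeasurable (fun x => f x + g x).
Proof.
move=> [fr fi] [gr gi]; split.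
  rewrite (_ : (fun x => _) = (fun x => complex.Re (f x) + complex.Re (g x))).
    exact: measurable_funD.
  by apply/funext => x; case: (f x) (g x) => [a b] [c d].
rewrite (_ : (fun x => _) = (fun x => complex.Im (f x) + complex.Im (g x))).
  exact: measurable_funD.
by apply/funext => x; case: (f x) (g x) => [a b] [c d].
Qed.

Lemma cmeasurableM f g : cmeasurable f -> cmeasurable g ->
  cmeasurable (fun x => f x * g x).
Proof.
move=> [fr fi] [gr gi]; split.
  rewrite (_ : (fun x => _) = (fun x => complex.Re (f x) * complex.Re (g x) -
      complex.Im (f x) * complex.Im (g x))).
    by apply: measurable_funB; exact: measurable_funM.
  by apply/funext => x; case: (f x) (g x) => [a b] [c d].
rewrite (_ : (fun x => _) = (fun x => complex.Re (f x) * complex.Im (g x) +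
      complex.Im (f x) * complex.Re (g x))).
  by apply: measurable_funD; exact: measurable_funM.
by apply/funext => x; case: (f x) (g x) => [a b] [c d].
Qed.

Lemma cmeasurable_cst z : cmeasurable (fun _ : T => z).
Proof. by split; exact: measurable_cst. Qed.

Lemma cmeasurable_real (u : T -> R) : measurable_fun setT u ->
  cmeasurable (fun x => (u x)%:C).
Proof. by move=> mu'; split => //=; exact: measurable_cst. Qed.

Lemma cmeasurable_expo xi : cmeasurable (@expo R xi : T -> R[i]).
Proof. by split; [exact: measurable_cosl|exact: measurable_sinl]. Qed.

Lemma cmeasurableN f : cmeasurable f -> cmeasurable (fun x => - f x).
Proof.
move=> mf; rewrite (_ : (fun x => _) = (fun x => (-1) * f x)).
  by apply: cmeasurableM => //; exact: cmeasurable_cst.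
by apply/funext => x; rewrite mulN1r.
Qed.

Lemma cmeasurableB f g : cmeasurable f -> cmeasurable g ->
  cmeasurable (fun x => f x - g x).
Proof. by move=> mf mg; apply: cmeasurableD => //; exact: cmeasurableN. Qed.

Lemma measurable_nsq f : cmeasurable f -> measurable_fun setT (fun x => nsq (f x)).
Proof. by move=> [fr fi]; apply: measurable_funD; exact: measurable_funX. Qed.

Lemma measurable_ensq f : cmeasurable f ->
  measurable_fun setT (fun x => (nsq (f x))%:E).
Proof. by move=> mf; apply/measurable_EFinP; exact: measurable_nsq. Qed.

Lemma L2norm_sqr f : (L2norm mu f `^ 2)%E = sq f.
Proof.
rewrite /L2norm poweR_Lnorm//; apply: eq_integral => x _.
rewrite /=; congr EFin; rewrite (powR_mulrn 2) ?normr_ge0//.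
case: (f x) => a b; rewrite /nsq /= ger0_norm ?sqrtr_ge0// sqr_sqrtr//.
by rewrite addr_ge0 ?sqr_ge0.
Qed.

Lemma L2norm_lty f : (sq f < +oo)%E -> (L2norm mu f < +oo)%E.
Proof. by rewrite -L2norm_sqr; exact: lty_poweRy. Qed.

Lemma sq_lty f : (L2norm mu f < +oo)%E -> (sq f < +oo)%E.
Proof. by rewrite -L2norm_sqr; exact: poweR_lty. Qed.

Lemma L2norm_lt f (e : R) : 0 < e -> (sq f < (e ^+ 2)%:E)%E ->
  (L2norm mu f < e%:E)%E.
Proof.
move=> e0; rewrite -L2norm_sqr ltNge => /negP h; rewrite ltNge; apply/negP => h'.
apply: h; have := @gt0_ler_poweR R 2 ltac:(by []) e%:E (L2norm mu f).
rewrite !in_itv/= !leey !andbT lee_fin (ltW e0) => /(_ isT (Lnorm_ge0 _ _ _) h').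
by rewrite /= (powR_mulrn 2)// ltW.
Qed.

Lemma sqD f g (a b : R) : cmeasurable f -> cmeasurable g ->
  (sq f < a%:E)%E -> (sq g < b%:E)%E ->
  (sq (fun x => (f x + g x)%R) < (2 * a + 2 * b)%:E)%E.
Proof.
move=> mf mg fa gb.
apply: (@le_lt_trans _ _ (2%:E * sq f + 2%:E * sq g)%E).
  rewrite /sq -!ge0_integralZl//; first last.
  all: try exact: measurable_ensq.
  all: try by move=> x _; rewrite lee_fin nsq_ge0.
  rewrite -ge0_integralD//; first last.
  all: try by apply: measurable_funeM; exact: measurable_ensq.
  all: try by move=> x _; rewrite mule_ge0// lee_fin nsq_ge0.
  apply: ge0_le_integral => //.
  - by move=> x _; rewrite lee_fin nsq_ge0.
  - by apply: measurable_ensq; exact: cmeasurableD.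
  - by apply: emeasurable_funD; apply: measurable_funeM; exact: measurable_ensq.
  - by move=> x _; rewrite -!EFinM -EFinD lee_fin nsqD.
have -> : (2 * a + 2 * b)%:E = (2%:E * a%:E + 2%:E * b%:E)%E by [].
by rewrite lteD// lte_pmul2l.
Qed.

Lemma sqZ f z : cmeasurable f -> (sq (fun x => (z * f x)%R) = (nsq z)%:E * sq f)%E.
Proof.
move=> mf; rewrite /sq -ge0_integralZl//.
- by apply: eq_integral => x _; rewrite nsqM EFinM.
- exact: measurable_ensq.
- by move=> x _; rewrite lee_fin nsq_ge0.
- by rewrite lee_fin nsq_ge0.
Qed.

Lemma sq_dominated (f : nat -> T -> R[i]) g G : (forall n, cmeasurable (f n)) ->
  cmeasurable g -> mu.-integrable setT (EFin \o G) ->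
  (forall n x, nsq (g x - f n x) <= G x) ->
  (forall x, nsq (g x - f n x) @[n --> \oo] --> 0) ->
  forall e : R, 0 < e -> exists n, (sq (fun x => (g x - f n x)%R) < e%:E)%E.
Proof.
move=> mf mg iG fG f0 e e0.
pose d n x := (nsq (g x - f n x))%:E.
have md n : measurable_fun setT (d n).
  by apply: measurable_ensq; exact: cmeasurableB.
have cd : {ae mu, forall x, setT x -> d ^~ x @ \oo --> cst 0%E x}.
  by apply: aeW => x _; apply: cvg_EFin; [exact: nearW|exact: f0].
have dG : {ae mu, forall x n, setT x -> (`|d n x| <= (EFin \o G) x)%E}.
  by apply: aeW => x n _; rewrite lee_fin ger0_norm ?nsq_ge0.
have [_ _] := dominated_convergence measurableT md (measurable_cst _) cd iG dG.
rewrite integral0 => h.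
have /h[n0 _ /(_ n0 (leqnn _))] : nbhs (0%E : \bar R) [set y : \bar R | (y < e%:E)%E].
  apply: open_nbhs_nbhs; split; first exact: open_ereal_lt_ereal.
  by rewrite /= lte_fin.
by exists n0.
Qed.

End square_norm.

(** * Trigonometric polynomials *)

Section trigonometric_polynomials.
Context {R : realType} (mu : probability (measurableTypeR R) R).
Local Notation T := (measurableTypeR R).
Implicit Types (f g : T -> R[i]) (xi eta : R) (w : seq (R * R[i])).

#[local] Arguments conjc {R} x : simpl never.

(** Frequencies may repeat in the list, so that sums of polynomials are
    concatenations. *)
Definition tpoly w (x : T) : R[i] := \sum_(u <- w) u.2 * expo u.1 x.
Definition mhat xi : R[i] := fcos mu xi +i* fsin mu xi.

Lemma expoD xi eta x : expo (xi + eta) x = expo xi x * expo eta x :> R[i].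
Proof.
rewrite /expo /=.
have -> : 2 * pi * (xi + eta) * x = 2 * pi * xi * x + 2 * pi * eta * x by ring.
by rewrite cosD sinD; congr (_ +i* _); ring.
Qed.

Lemma expo_conj xi x : conjc (expo xi x) = expo (- xi) x :> R[i].
Proof.
rewrite /expo /=.
have -> : 2 * pi * - xi * x = - (2 * pi * xi * x) by ring.
by rewrite cosN sinN.
Qed.

Lemma nsq_expo xi x : nsq (expo xi x : R[i]) = 1.
Proof. by rewrite /nsq /= cos2Dsin2. Qed.

Lemma mhat_conj xi : conjc (mhat xi) = mhat (- xi).
Proof.
have e x : 2 * pi * - xi * x = - (2 * pi * xi * x) by ring.
rewrite /mhat /fcos /fsin; congr (_ +i* _).
  by apply: eq_Rintegral => x _; rewrite e cosN.
transitivity (-1 * \int[mu]_x sin (2 * pi * xi * x)); first by rewrite mulN1r.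
rewrite -RintegralZl//; last exact: integrable_sin.
by apply: eq_Rintegral => x _; rewrite e sinN mulN1r.
Qed.

Lemma nsq_mhat xi : nsq (mhat xi) = pspec mu xi.
Proof. by []. Qed.

Lemma mhat0 : mhat 0 = 1.
Proof. by rewrite /mhat fcos0 fsin0. Qed.

Lemma pspecN xi : pspec mu (- xi) = pspec mu xi.
Proof. by rewrite -!nsq_mhat -mhat_conj /nsq /= sqrrN. Qed.

Lemma cmeasurable_tpoly w : cmeasurable (tpoly w).
Proof.
elim: w => [|u w IH].
  rewrite (_ : tpoly _ = fun=> 0); first exact: cmeasurable_cst.
  by apply/funext => x; rewrite /tpoly big_nil.
rewrite (_ : tpoly _ = fun x => u.2 * expo u.1 x + tpoly w x).
  apply: cmeasurableD => //; apply: cmeasurableM; first exact: cmeasurable_cst.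
  exact: cmeasurable_expo.
by apply/funext => x; rewrite /tpoly big_cons.
Qed.

Lemma Re_tpoly_int w : mu.-integrable setT (fun x => (complex.Re (tpoly w x))%:E) /\
  \int[mu]_x complex.Re (tpoly w x) = complex.Re (\sum_(u <- w) u.2 * mhat u.1).
Proof.
elim: w => [|[xi [a b]] w [iw ew]].
  split.
    by under eq_fun do rewrite /tpoly big_nil/=; exact: integrable0.
  under eq_Rintegral do rewrite /tpoly big_nil/=.
  by rewrite big_nil Rintegral_cst// mul0r.
pose h x := a * cos (2 * pi * xi * x) - b * sin (2 * pi * xi * x) : R.
have hE (x : T) : complex.Re (tpoly ((xi, a +i* b) :: w) x) = h x + complex.Re (tpoly w x).
  by rewrite /tpoly big_cons/=; case: (\sum_(_ <- _) _).
have ih1 : mu.-integrable setT (EFin \o (fun x : T => a * cos (2 * pi * xi * x))).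
  exact: (integrableZl measurableT a (integrable_cos mu xi)).
have ih2 : mu.-integrable setT (EFin \o (fun x : T => b * sin (2 * pi * xi * x))).
  exact: (integrableZl measurableT b (integrable_sin mu xi)).
have ih : mu.-integrable setT (EFin \o (h : T -> R)).
  exact: (integrableB measurableT ih1 ih2).
split.
  under eq_fun do rewrite hE; exact: (integrableD measurableT ih iw).
under eq_Rintegral do rewrite hE.
rewrite RintegralD// ew /h RintegralB// !RintegralZl//.
- rewrite big_cons/=; case: (\sum_(_ <- _) _) => c d /=.
  by [].
- exact: integrable_sin.
- exact: integrable_cos.
Qed.

Lemma conjcN (z : R[i]) : conjc (- z) = - conjc z.
Proof. exact: (rmorphN (@conjc R)). Qed.

Lemma conj_tpoly w x :
  conjc (tpoly w x) = \sum_(v <- w) conjc v.2 * expo (- v.1) x.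
Proof.
elim: w => [|u w IH]; first by rewrite /tpoly !big_nil conjc0.
rewrite /tpoly !big_cons -IH -expo_conj.
have e : conjc (u.2 * expo u.1 x) = conjc u.2 * conjc (expo u.1 x).
  exact: (rmorphM (@conjc R)).
by rewrite -e; exact: (rmorphD (@conjc R)).
Qed.

(** Expand the square into exponentials and integrate term by term. *)
Lemma sq_tpoly w : sq mu (tpoly w) =
  (complex.Re (\sum_(u <- w) \sum_(v <- w) u.2 * conjc v.2 * mhat (u.1 - v.1)))%:E.
Proof.
pose W := [seq (u.1 - v.1, u.2 * conjc v.2) | u <- w, v <- w].
have WE x : nsq (tpoly w x) = complex.Re (tpoly W x).
  have -> : nsq (tpoly w x) = complex.Re ((nsq (tpoly w x))%:C) by [].
  rewrite nsq_conj conj_tpoly; congr complex.Re; rewrite /W /tpoly.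
  rewrite big_allpairs_dep/= mulr_suml; apply: eq_bigr => u _.
  by rewrite mulr_sumr; apply: eq_bigr => v _; rewrite expoD; ring.
have [iW eW] := Re_tpoly_int W.
rewrite /sq; under eq_integral do rewrite WE.
rewrite -[LHS]fineK; last exact: (integrable_fin_num _ iW).
by congr EFin; apply: etrans eW _; rewrite /W big_allpairs_dep.
Qed.

(** The Bessel identity: for an orthogonal family of exponentials the squared
    distance from e_xi to its orthogonal projection is 1 minus the sum of the
    squared coefficients. *)
Lemma sq_expo_approx xi (s : seq R) : uniq s ->
  {in s &, forall l l', l != l' -> mhat (l - l') = 0} ->
  sq mu (fun x => (expo xi x - tpoly [seq (l, mhat (xi - l)) | l <- s] x)%R) =
  (1 - \sum_(l <- s) pspec mu (xi - l))%:E.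
Proof.
move=> us os; pose w := (xi, 1) :: [seq (l, - mhat (xi - l)) | l <- s].
rewrite (_ : (fun _ => _) = tpoly w); last first.
  apply/funext => x; rewrite /tpoly big_cons/= mul1r !big_map/=; congr (_ + _).
  by rewrite -sumrN; apply: eq_bigr => l _; rewrite mulNr.
rewrite sq_tpoly; congr EFin.
set S : R := \sum_(l <- s) _.
suff -> : \sum_(u <- w) \sum_(v <- w) u.2 * conjc v.2 * mhat (u.1 - v.1) = (1 - S)%:C by [].
have SE : S%:C = \sum_(l <- s) mhat (xi - l) * conjc (mhat (xi - l)).
  by rewrite /S (rmorph_sum (real_complex R)); apply: eq_bigr => l _; rewrite -nsq_conj.
rewrite big_cons/= big_cons/= !big_map/= subrr mhat0.
have -> : \sum_(l <- s) 1 * conjc (- mhat (xi - l)) * mhat (xi - l) = - S%:C.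
  by rewrite SE -sumrN; apply: eq_bigr => l _; rewrite conjcN; ring.
have -> : \sum_(l <- s) \sum_(v <- w) - mhat (xi - l) * conjc v.2 * mhat (l - v.1) = 0.
  rewrite big_seq big1// => l ls; rewrite big_cons/= big_map/=.
  rewrite (bigD1_seq l)//= big_seq_cond big1 => [|l' /andP[l's ll']].
    rewrite addr0 subrr mhat0 conjcN -(opprB xi l) -mhat_conj conjc1; ring.
  have ne : l != l' by rewrite eq_sym.
  by rewrite (os l l' ls l's ne) mulr0.
by rewrite conjc1 !mulr1 addr0 rmorphB.
Qed.

End trigonometric_polynomials.

(** * Density of the closed span *)

Import HBNNSimple.

Section density.
Context {R : realType} (mu : probability (measurableTypeR R) R).
Local Notation T := (measurableTypeR R).
Variable J : set R.
Implicit Types (f g : T -> R[i]) (u v : T -> R) (xi eta : R).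

(** Membership in the closed linear span of the exponentials with frequency in
    J. *)
Definition appr f := forall e : R, 0 < e -> exists w : seq (R * R[i]),
  (forall t, t \in w -> J t.1) /\ (sq mu (fun x => (f x - tpoly w x)%R) < e%:E)%E.

Lemma appr_lim f : cmeasurable f ->
  (forall e : R, 0 < e -> exists g, [/\ cmeasurable g, appr g &
    (sq mu (fun x => (f x - g x)%R) < e%:E)%E]) -> appr f.
Proof.
move=> mf H e e0; have e4 : 0 < e / 4 by lra.
have [g [mg ag fg]] := H _ e4; have [w [wJ gw]] := ag _ e4.
exists w; split => //.
rewrite (_ : (fun _ => _) = (fun x => (f x - g x) + (g x - tpoly w x))); last first.
  by apply/funext => x; rewrite addrA subrK.
have -> : e = 2 * (e / 4) + 2 * (e / 4) by field.
apply: sqD => //; apply: cmeasurableB => //; exact: cmeasurable_tpoly.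
Qed.

Lemma apprD f g : cmeasurable f -> cmeasurable g -> appr f -> appr g ->
  appr (fun x => f x + g x).
Proof.
move=> mf mg af ag e e0; have e4 : 0 < e / 4 by lra.
have [w1 [J1 h1]] := af _ e4; have [w2 [J2 h2]] := ag _ e4.
exists (w1 ++ w2); split.
  by move=> t; rewrite mem_cat => /orP[/J1|/J2].
rewrite (_ : (fun _ => _) = (fun x => (f x - tpoly w1 x) + (g x - tpoly w2 x))); last first.
  by apply/funext => x; rewrite /tpoly big_cat/=; ring.
have -> : e = 2 * (e / 4) + 2 * (e / 4) by field.
by apply: sqD => //; apply: cmeasurableB => //; exact: cmeasurable_tpoly.
Qed.

Lemma apprZ z f : cmeasurable f -> appr f -> appr (fun x => z * f x).
Proof.
move=> mf af e e0; have z0 := nsq_ge0 z.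
have e1 : 0 < e / (nsq z + 1) by rewrite divr_gt0// ltr_wpDl.
have [w [wJ h]] := af _ e1; exists [seq (t.1, z * t.2) | t <- w]; split.
  by move=> t /mapP[t' /wJ ? ->].
rewrite (_ : (fun _ => _) = (fun x => z * (f x - tpoly w x))); last first.
  apply/funext => x; rewrite mulrBr; congr (_ - _).
  by rewrite /tpoly big_map mulr_sumr; apply: eq_bigr => t _; rewrite mulrA.
rewrite sqZ; last by apply: cmeasurableB => //; exact: cmeasurable_tpoly.
apply: (@le_lt_trans _ _ ((nsq z)%:E * (e / (nsq z + 1))%:E)%E).
  by apply: lee_wpmul2l; rewrite ?lee_fin// ltW.
by rewrite -EFinM lte_fin mulrCA gtr_pMr// ltr_pdivrMr ?mul1r ?ltrDl// ltr_wpDl.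
Qed.

(** Real functions all of whose modulations lie in the closed span.  Unlike
    the closed span itself, this class is visibly closed under multiplication
    by sines and cosines. *)
Definition rappr u := measurable_fun setT u /\
  forall xi, appr (fun x => (u x)%:C * expo xi x).

Lemma cmeasurable_modulated u xi : measurable_fun setT u ->
  cmeasurable (fun x : T => (u x)%:C * expo xi x).
Proof.
by move=> mu'; apply: cmeasurableM; [exact: cmeasurable_real|exact: cmeasurable_expo].
Qed.

Lemma rapprD u v : rappr u -> rappr v -> rappr (fun x => u x + v x).
Proof.
move=> [mu' au] [mv av]; split=> [|xi]; first exact: measurable_funD.
rewrite (_ : (fun _ => _) = (fun x => (u x)%:C * expo xi x + (v x)%:C * expo xi x)).
  by apply: apprD => //; exact: cmeasurable_modulated.
by apply/funext => x; rewrite -mulrDl -rmorphD.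
Qed.

Lemma rapprZ (a : R) u : rappr u -> rappr (fun x => a * u x).
Proof.
move=> [mu' au]; split=> [|xi]; first exact: measurable_funM.
rewrite (_ : (fun _ => _) = (fun x => a%:C * ((u x)%:C * expo xi x))).
  by apply: apprZ => //; exact: cmeasurable_modulated.
by apply/funext => x; rewrite mulrA -rmorphM.
Qed.

Lemma rapprB u v : rappr u -> rappr v -> rappr (fun x => u x - v x).
Proof.
move=> au av; rewrite (_ : (fun _ => _) = (fun x => u x + (-1) * v x)).
  by apply: rapprD => //; exact: rapprZ.
by apply/funext => x; rewrite mulN1r.
Qed.

(** Multiplying by a cosine averages the modulations by xi + eta and xi - eta.
    *)
Lemma rappr_cos eta u : rappr u -> rappr (fun x => u x * cos (2 * pi * eta * x)).
Proof.
move=> [mu' au]; split=> [|xi].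
  by apply: measurable_funM => //; exact: measurable_cosl.
rewrite (_ : (fun _ => _) = (fun x => (2^-1)%:C * ((u x)%:C * expo (xi + eta) x) +
    (2^-1)%:C * ((u x)%:C * expo (xi - eta) x))).
  apply: apprD.
  1-2: by apply: cmeasurableM;
    [exact: cmeasurable_cst|exact: cmeasurable_modulated].
  1-2: by apply: apprZ => //; exact: cmeasurable_modulated.
apply/funext => x; rewrite !expoD -expo_conj.
by case: (expo xi x) => a b; rewrite /expo /=; congr (_ +i* _); field.
Qed.

Lemma rappr_sin eta u : rappr u -> rappr (fun x => u x * sin (2 * pi * eta * x)).
Proof.
move=> [mu' au]; split=> [|xi].
  by apply: measurable_funM => //; exact: measurable_sinl.
rewrite (_ : (fun _ => _) = (fun x => (0 -i* 2^-1) * ((u x)%:C * expo (xi + eta) x) +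
    (0 +i* 2^-1) * ((u x)%:C * expo (xi - eta) x))).
  apply: apprD.
  1-2: by apply: cmeasurableM;
    [exact: cmeasurable_cst|exact: cmeasurable_modulated].
  1-2: by apply: apprZ => //; exact: cmeasurable_modulated.
apply/funext => x; rewrite !expoD -expo_conj.
by case: (expo xi x) => a b; rewrite /expo /=; congr (_ +i* _); field.
Qed.

Lemma nsq_modulated (a : R) xi (x : T) : nsq (a%:C * expo xi x) = a ^+ 2.
Proof. by rewrite nsqM nsq_real nsq_expo mulr1. Qed.

Lemma modulatedB (a b : R) xi (x : T) :
  a%:C * expo xi x - b%:C * expo xi x = (a - b)%:C * expo xi x.
Proof. by rewrite -mulrBl -rmorphB. Qed.

(** Membership passes to dominated pointwise limits, since these are limits in
    the square norm for each modulation. *)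
Lemma rappr_lim (un : nat -> T -> R) u (G : T -> R) : (forall n, rappr (un n)) ->
  (forall x, un n x @[n --> \oo] --> u x) ->
  mu.-integrable setT (EFin \o G) -> (forall n x, (u x - un n x) ^+ 2 <= G x) ->
  rappr u.
Proof.
move=> aun ul iG uG.
have mu' : measurable_fun setT u.
  by apply: (@measurable_fun_cvg _ _ _ _ un) => [n|x _]; [exact: (aun n).1|exact: ul].
split=> // xi; apply: appr_lim => [|e e0]; first exact: cmeasurable_modulated.
have [||||n hn] := @sq_dominated _ mu (fun n x => (un n x)%:C * expo xi x)
    (fun x => (u x)%:C * expo xi x) G _ _ iG _ _ e e0.
- by move=> n; apply: cmeasurable_modulated; exact: (aun n).1.
- exact: cmeasurable_modulated.
- by move=> n x; rewrite modulatedB nsq_modulated.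
- move=> x; have cv0 : (fun n => u x - un n x) @ \oo --> (0 : R).
    by rewrite -(subrr (u x)); apply: cvgB; [exact: cvg_cst|exact: ul].
  have cv := cvgM cv0 cv0.
  rewrite mulr0 in cv.
  have e1 : (fun n => nsq ((u x)%:C * expo xi x - (un n x)%:C * expo xi x)) =
      (fun n => (u x - un n x) * (u x - un n x)).
    by apply/funext => n; rewrite modulatedB nsq_modulated expr2.
  by rewrite e1; exact: cv.
exists (fun x => (un n x)%:C * expo xi x); split => //.
  by apply: cmeasurable_modulated; exact: (aun n).1.
exact: (aun n).2.
Qed.

Lemma rappr_lim_bounded (un : nat -> T -> R) u (K : R) : (forall n, rappr (un n)) ->
  (forall x, un n x @[n --> \oo] --> u x) ->
  (forall n x, `|u x - un n x| <= K) -> rappr u.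
Proof.
move=> aun ul uK; apply: (@rappr_lim un u (cst (K ^+ 2))) => //.
  by apply: (@bounded_integrable _ mu _ `|K ^+ 2|).
by move=> n x; rewrite -real_normK ?num_real// lerXn2r ?nnegrE// (le_trans _ (uK n x)).
Qed.

Hypothesis Jdense : forall xi, appr (@expo R xi).

Lemma rappr1 : rappr (fun=> 1).
Proof.
split=> [|xi]; first exact: measurable_cst.
rewrite (_ : (fun _ => _) = @expo R xi) => //.
by apply/funext => x; rewrite mul1r.
Qed.

Hypothesis supp : mu [set x : T | 1 < `|x|] = 0%E.

(** Two functions that agree on [-1, 1] agree almost everywhere. *)
Lemma rappr_supp u v : measurable_fun setT v -> rappr u ->
  (forall x, `|x| <= 1 -> v x = u x) -> rappr v.
Proof.
move=> mv [mu' au] uv; split=> // xi; apply: appr_lim => [|e e0].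
  exact: cmeasurable_modulated.
exists (fun x => (u x)%:C * expo xi x); split => //.
  exact: cmeasurable_modulated.
rewrite (_ : sq _ _ = 0%E) ?lte_fin// /sq.
have mc : cmeasurable (fun x : T => (v x)%:C * expo xi x - (u x)%:C * expo xi x).
  by apply: cmeasurableB; exact: cmeasurable_modulated.
rewrite (@ae_eq_integral _ _ _ mu setT (cst 0%E)) ?integral0//.
- exact: measurable_ensq.
- exists [set x : T | 1 < `|x|]; split => //; first exact: measurable_norm_gt.
  move=> x /= h; rewrite ltNge; apply/negP => x1.
  by apply: h => _; rewrite modulatedB nsq_modulated uv// subrr expr0n.
Qed.

(** The trigonometric polynomial q = (1 + sin(2 pi eta (x - a))) / 2, with eta
    so small that the argument of the sine stays in [-pi/2, pi/2] on [-1, 1],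
    is less than 1/2 there exactly when x < a. *)
Lemma rappr_ray (a : R) : rappr (\1_(`]-oo, a[%classic : set T) : T -> R).
Proof.
pose eta := (4 * (1 + `|a|))^-1.
have a0 := normr_ge0 a; have eta0 : 0 < eta by rewrite invr_gt0; lra.
pose q (x : T) := (1 + sin (2 * pi * eta * (x - a))) / 2.
have q01 x : 0 <= q x <= 1.
  by have := sin_geN1 (2 * pi * eta * (x - a)); have := sin_le1 (2 * pi * eta * (x - a));
     rewrite /q; lra.
have qmul u : rappr u -> rappr (fun x => u x * q x).
  move=> au; rewrite (_ : (fun _ => _) = (fun x => 2^-1 * u x +
     ((cos (2 * pi * eta * a) / 2) * (u x * sin (2 * pi * eta * x)) -
      (sin (2 * pi * eta * a) / 2) * (u x * cos (2 * pi * eta * x))))).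
    apply: rapprD; first exact: rapprZ.
    by apply: rapprB; apply: rapprZ; [exact: rappr_sin|exact: rappr_cos].
  apply/funext => x; rewrite /q.
  have -> : 2 * pi * eta * (x - a) = 2 * pi * eta * x - 2 * pi * eta * a by ring.
  by rewrite sinB; field.
have qX n u : rappr u -> rappr (fun x => u x * q x ^+ n).
  elim: n u => [|n IH] u au.
    by rewrite (_ : (fun _ => _) = u)//; apply/funext => x; rewrite mulr1.
  rewrite (_ : (fun _ => _) = (fun x => (u x * q x) * q x ^+ n)).
    exact/IH/qmul.
  by apply/funext => x; rewrite exprS mulrA.
have qXm n m : rappr (fun x => (1 - q x ^+ n) ^+ m).
  elim: m => [|m IH]; first exact: rappr1.
  rewrite (_ : (fun _ => _) = (fun x => (1 - q x ^+ n) ^+ m -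
      (1 - q x ^+ n) ^+ m * q x ^+ n)).
    by apply: rapprB => //; exact: qX.
  by apply/funext => x; rewrite exprS; ring.
apply: (@rappr_supp (fun x => (q x < 2^-1)%R%:R)).
- exact: measurable_indic.
- apply: (@rappr_lim_bounded (fun n x => (1 - q x ^+ n) ^+ (n * 2 ^ n)) _ 1) => //.
    by move=> x; exact: cvg_sharp.
  move=> n x; have := q01 x; have /andP[] : 0 <= (1 - q x ^+ n) ^+ (n * 2 ^ n) <= 1.
    have /andP[q0 q1] := q01 x.
    have /andP[y0 y1] : 0 <= 1 - q x ^+ n <= 1.
      by rewrite subr_ge0 exprn_ile1//= lerBlDr lerDl exprn_ge0.
    by rewrite exprn_ge0// exprn_ile1.
  by case: (_ < _) => y0 y1 _; rewrite ler_norml; apply/andP; split => /=; lra.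
- move=> x x1; rewrite indicE; congr (nat_of_bool _)%:R.
  have xa : `|x - a| <= 1 + `|a| by rewrite (le_trans (ler_normB _ _))// lerD2r.
  have tE : 2 * pi * eta * (x - a) = (x - a) / (1 + `|a|) * (pi / 2).
    by rewrite /eta; field; rewrite gt_eqF//; lra.
  have xaN : `|(x - a) / (1 + `|a|)| <= 1.
    rewrite normrM normfV (@ger0_norm _ (1 + `|a|)); last by lra.
    by rewrite ler_pdivrMr ?mul1r//; lra.
  have p0 := pi_gt0 R.
  apply/idP/idP => [|].
    rewrite inE/= in_itv/= => xlt; rewrite /q.
    suff : 0 < sin (- (2 * pi * eta * (x - a))) by rewrite sinN; lra.
    apply: sin_gt0_pi; rewrite tE -mulNr.
    have y0 : 0 < - ((x - a) / (1 + `|a|)).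
      by rewrite -mulNr divr_gt0//; lra.
    by move: xaN; rewrite ler_norml => /andP[yl yr]; apply/andP; split; nra.
  apply: contraTT; rewrite notin_setE/= in_itv/= => /negP; rewrite -leNgt => xge.
  rewrite -leNgt /q; suff : 0 <= sin (2 * pi * eta * (x - a)) by lra.
  apply: sin_ge0_pi; rewrite tE.
  have y0 : 0 <= (x - a) / (1 + `|a|) by rewrite divr_ge0//; lra.
  by move: xaN; rewrite ler_norml => /andP[yl yr]; apply/andP; split; nra.
Qed.

Lemma rappr_sum (I : Type) (s : seq I) (F : I -> T -> R) :
  (forall i, rappr (F i)) -> rappr (fun x => \sum_(i <- s) F i x).
Proof.
move=> aF; elim: s => [|i s IH].
  rewrite (_ : (fun _ => _) = (fun x => 0 * 1)); first exact: rapprZ rappr1.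
  by apply/funext => x; rewrite big_nil mul0r.
rewrite (_ : (fun _ => _) = (fun x => F i x + \sum_(i <- s) F i x)).
  exact: rapprD.
by apply/funext => x; rewrite big_cons.
Qed.

(** The half-lines form a generating family stable under intersection, and the
    sets whose indicator is in the class form a Dynkin system. *)
Lemma rappr_indic (A : set T) : measurable A -> rappr (\1_A : T -> R).
Proof.
move=> mA; apply: (@dynkin_induction _ T (@RGenInftyO.G R)
   (fun A => rappr (\1_A : T -> R))).
- exact: RGenInftyO.measurableE.
- move=> _ _ [x ->] [y ->]; exists (Num.min x y).
  apply/seteqP; split => z /=; rewrite !in_itv/= lt_min; last by move=> /andP[].
  by move=> [-> ->].
- by rewrite indicT; exact: rappr1.
- by move=> _ [x ->]; exact: rappr_ray.
- move=> S mS aS; rewrite (_ : \1__ = (fun x => 1 - \1_S x)).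
    by apply: rapprB => //; exact: rappr1.
  apply/funext => x; rewrite indicC indicE.
  by case: (x \in S); rewrite ?subrr ?subr0.
- move=> F mF tF aF.
  have sumE x n : \sum_(k <- iota 0 n) \1_(F k) x =
      `[< exists2 k, (k < n)%N & F k x >]%:R :> R.
    case: asboolP => [[k kn Fkx]|nF].
      rewrite (bigD1_seq k) ?mem_iota ?iota_uniq//= indicE mem_set// big1 ?addr0//.
      move=> l lk; rewrite indicE memNset// => Flx; move/eqP: lk; apply.
      by apply: (tF l k) => //; exists x.
    rewrite big_seq big1// => k; rewrite mem_iota/= add0n => kn.
    by rewrite indicE memNset// => Fkx; apply: nF; exists k.
  apply: (@rappr_lim_bounded (fun n x => \sum_(k <- iota 0 n) \1_(F k) x) _ 1).
  + by move=> n; exact: rappr_sum.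
  + move=> x; rewrite indicE; have [/set_mem[k _ Fkx]|xF] := boolP (x \in _).
      apply: cvg_near_cst; exists k.+1 => // n /= kn; rewrite sumE.
      by case: asboolP => // -[]; exists k.
    apply: cvg_near_cst; exists 0%N => // n _; rewrite sumE.
    by case: asboolP => // -[k _ Fkx]; case/negP: xF; rewrite inE; exists k.
  + move=> n x; rewrite sumE indicE.
    by case: asboolP => _; case: (_ \in _); rewrite ?subrr ?subr0 ?sub0r ?normrN ?normr0 ?normr1.
- exact: (eq_ind _ (fun P : set_system T => P A) mA _ (RGenInftyO.measurableE R)).
Qed.

(** Increasing simple functions converge to u with squared error at most u^2.
    *)
Lemma rappr_ge0 u : measurable_fun setT u -> (forall x, 0 <= u x) ->
  mu.-integrable setT (EFin \o (fun x => u x ^+ 2)) -> rappr u.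
Proof.
move=> mu' u0 iu.
have mEu : measurable_fun setT (EFin \o u) by exact/measurable_EFinP.
have [gn [ndg cg]] := approximation measurableT mEu (fun x _ => u0 x).
have cg' x : gn n x @[n --> \oo] --> u x.
  by have /fine_cvgP[] := cg x I.
apply: (@rappr_lim (fun n => gn n : T -> R) u (fun x => u x ^+ 2)) => // [n|n x].
  rewrite (_ : (gn n : T -> R) = (fun x => \sum_(y <- finmap.enum_fset (fset_set (range (gn n))))
     y * \1_(gn n @^-1` [set y]) x)).
    by apply: rappr_sum => y; apply: rapprZ; exact: rappr_indic.
  by apply/funext => x; rewrite fimfunE fsbig_finite.
have g0 : 0 <= gn n x by [].
have gu : gn n x <= u x.
  rewrite -(cvg_lim _ (cg' x))//; apply: nondecreasing_cvgn_le.
    by move=> m k mk; exact/lefP/ndg.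
  by apply/cvg_ex; exists (u x).
by rewrite lerXn2r ?nnegrE ?subr_ge0// lerBlDr lerDl.
Qed.

Lemma appr_L2 f : cmeasurable f -> (sq mu f < +oo)%E -> appr f.
Proof.
move=> mf sf.
have isq u : measurable_fun setT u -> (forall x, u x ^+ 2 <= nsq (f x)) ->
    mu.-integrable setT (EFin \o (fun x => u x ^+ 2)).
  move=> mu' uf; apply: (@le_integrable _ _ _ mu setT measurableT _ (fun x => (nsq (f x))%:E)).
  - by apply/measurable_EFinP; exact: measurable_funX.
  - by move=> x _ /=; rewrite lee_fin !ger0_norm ?sqr_ge0 ?nsq_ge0.
  - apply/integrableP; split; first exact: measurable_ensq.
    by under eq_integral do rewrite gee0_abs ?lee_fin ?nsq_ge0//.
have real u : measurable_fun setT u -> (forall x, u x ^+ 2 <= nsq (f x)) -> rappr u.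
  move=> mu' uf.
  rewrite (_ : u = (fun x => Num.max (u x) 0 - Num.max (- u x) 0)); last first.
    apply/funext => x; have [h|h] := leP (u x) 0.
      by rewrite max_l ?oppr_ge0// sub0r opprK.
    by rewrite max_r ?oppr_le0 ?subr0// ltW.
  have mp : measurable_fun setT (fun x => Num.max (u x) 0).
    by apply: measurable_maxr => //; exact: measurable_cst.
  have mn : measurable_fun setT (fun x => Num.max (- u x) 0).
    by apply: measurable_maxr; [exact: measurableT_comp|exact: measurable_cst].
  apply: rapprB; apply: rappr_ge0 => // [x|]; rewrite ?le_max ?lexx ?orbT//.
    apply: isq => // x; apply: le_trans (uf x); rewrite /Num.max; case: ltP => // _.
    by rewrite expr0n sqr_ge0.
  apply: isq => // x; apply: le_trans (uf x); rewrite /Num.max; case: ltP => // _.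
    by rewrite expr0n sqr_ge0.
  by rewrite sqrrN.
have [mr mi] := mf.
have ar : rappr (fun x => complex.Re (f x)).
  by apply: real => // x; rewrite lerDl sqr_ge0.
have ai : rappr (fun x => complex.Im (f x)).
  by apply: real => // x; rewrite lerDr sqr_ge0.
have e0 x : expo 0 x = 1 :> R[i] by rewrite /expo mulr0 mul0r cos0 sin0.
rewrite (_ : f = (fun x => (complex.Re (f x))%:C * expo 0 x +
   (0 +i* 1) * ((complex.Im (f x))%:C * expo 0 x))).
  apply: apprD; last apply: apprZ.
  - exact: cmeasurable_modulated.
  - by apply: cmeasurableM; [exact: cmeasurable_cst|exact: cmeasurable_modulated].
  - exact: ar.2.
  - exact: cmeasurable_modulated.
  - exact: ai.2.
apply/funext => x; rewrite e0 !mulr1; case: (f x) => a b /=.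
by congr (_ +i* _); ring.
Qed.

End density.

(** * The spectrum *)

Section spectrum.
Context {R : realType} (mu : probability (measurableTypeR R) R).
Hypothesis hmu : is_mu4 mu.
Variable p : int.
Hypothesis op : odd `|p|%N.
Local Notation T := (measurableTypeR R).
Local Notation pLambda := [set ((p * l)%:~R : R) | l in Lambda A1].

Lemma p_neq0 : p != 0.
Proof. by apply: contraTneq op => ->. Qed.

Lemma mhat_zero xi : pspec mu xi = 0 -> mhat mu xi = 0.
Proof.
move/eqP; rewrite paddr_eq0 ?sqr_ge0// !sqrf_eq0 => /andP[/eqP hc /eqP hs].
by rewrite /mhat hc hs.
Qed.

Lemma orthogonal_Lambda l l' : Lambda A1 l -> Lambda A1 l' -> l != l' ->
  mhat mu ((p * l)%:~R - (p * l')%:~R) = 0.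
Proof.
move=> /LambdaP[n ln] /LambdaP[n' ln'] ll'.
have mem k k' (u : int) : u \in digit_sums A1 k -> u \in digit_sums A1 (k + k').
  by have [s ->] := digit_sums_prefix A1 k k'; rewrite mem_cat => ->.
have l'n : l' \in digit_sums A1 (n + n') by rewrite addnC; exact: mem.
have [j [m [_ om e]]] := digit_sums_sub A1_sign (mem _ n' _ ln) l'n (elimN eqP ll').
apply: mhat_zero; rewrite -rmorphB/= -mulrBr e mulrCA; apply: pspec_zero => //.
by rewrite abszM oddM op om.
Qed.

(** By the Bessel identity the distance is measured by the defect in the
    Parseval sums; the sign of xi changes because the coefficients are values
    of the transform at xi - p l. *)
Lemma expo_approx xi : appr mu pLambda (@expo R xi).
Proof.
move=> e e0; have e2 : 0 < e / 2 by lra.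
have [N hN] := psum_complete hmu (- xi) op e2.
pose s := [seq (p * l)%:~R : R | l <- digit_sums A1 N].
have inL l : l \in digit_sums A1 N -> Lambda A1 l by move=> ?; apply/LambdaP; exists N.
exists [seq (l, mhat mu (xi - l)) | l <- s]; split.
  move=> t; rewrite -map_comp => /mapP[l lN ->] /=.
  by exists l => //; exact: inL.
rewrite sq_expo_approx; first last.
- move=> _ _ /mapP[l lN ->] /mapP[l' l'N ->] ne.
  apply: orthogonal_Lambda; [exact: inL|exact: inL|].
  by apply: contra ne => /eqP ->.
- rewrite map_inj_uniq ?digit_sums_uniq//; first exact: A1_sign.
  by move=> l l' /intr_inj /(mulfI p_neq0).
rewrite lte_fin big_map; move: hN; rewrite /psum.
have -> : \sum_(l <- digit_sums A1 N) pspec mu (xi - (p * l)%:~R) =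
    \sum_(l <- digit_sums A1 N) pspec mu (- xi + (p * l)%:~R).
  by apply: eq_bigr => l _; rewrite -pspecN opprB addrC.
lra.
Qed.

(** All frequencies are integers. *)
Lemma discrete_pLambda : discrete_subset pLambda.
Proof.
apply/seteqP; split => [x /isolatedS//|x xL]; split; first exact: mem_set.
exists (ball x 1); first exact: nbhsx_ballx.
apply/seteqP; split => [y [xy yL]|_ ->]; last by split => //; exact: ballxx.
case: xL yL xy => [l _ <-] [l' _ <-]; rewrite -ball_normE /= -rmorphB/= -intr_norm.
by rewrite (ltrz1 R) => h; congr (_%:~R); lia.
Qed.

Lemma orthonormal_pLambda : orthonormal_family mu pLambda (@expo R).
Proof.
split=> [xi _|].
  split; first exact: cmeasurable_expo.
  apply: L2norm_lty; rewrite /sq; under eq_integral do rewrite nsq_expo.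
  by rewrite integral_cst// mul1e (@le_lt_trans _ _ 1%E) ?probability_le1// ltry.
have innerE xi eta : L2inner mu (@expo R xi) (@expo R eta) = mhat mu (xi - eta).
  have e (x : T) : @expo R xi x * Num.conj (@expo R eta x) = @expo R (xi - eta) x.
    by rewrite expoD -expo_conj.
  rewrite /L2inner /cintegral /mhat /fcos /fsin.
  by congr (_ +i* _); apply: eq_Rintegral => x _; rewrite e.
move=> _ _ [l lL <-] [l' l'L <-]; rewrite innerE eqr_int (inj_eq (mulfI p_neq0)).
have [->|ne] := eqVneq l l'; first by rewrite subrr mhat0.
exact: orthogonal_Lambda.
Qed.

Lemma total_pLambda : total_family mu pLambda (@expo R).
Proof.
move=> f [mf /sq_lty sf] e e0.
have [w [wJ h]] := appr_L2 expo_approx (mu4_support hmu) mf sf (exprn_gt0 2 e0).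
(* repeated frequencies of w are merged, their coefficients being added *)
exists (undup [seq t.1 | t <- w]), (fun i => \sum_(t <- w | t.1 == i) t.2); split.
  by move=> i; rewrite mem_undup => /mapP[t tw ->]; exact: wJ.
apply: L2norm_lt => //.
rewrite (_ : (fun _ => _) = (fun x => f x - tpoly w x))//.
apply/funext => x; congr (_ - _); rewrite /tpoly.
under eq_bigr do rewrite mulr_suml.
rewrite (exchange_big_dep predT)//= big_seq [RHS]big_seq; apply: eq_bigr => t tw.
rewrite (eq_bigl (pred1 t.1)) => [|i]; last exact: eq_sym.
by rewrite -big_filter filter_pred1_uniq ?undup_uniq ?mem_undup ?map_f// big_seq1.
Qed.

End spectrum.

Theorem theorem4p9 (R : realType) (mu : probability (measurableTypeR R) R)
    (hmu : is_mu4 mu) (p : int) (hp : odd `|p|%N) :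
  is_spectrum mu [set (p * l)%:~R | l in Lambda A1].
Proof.
split; first exact: discrete_pLambda.
by split; [exact: orthonormal_pLambda|exact: total_pLambda].
Qed.
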